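(* Let $n<N$ be positive integers and let $A=[a_1,\dots,a_N]\in\mathbb{C}^{n\times N}$ be a random matrix whose entries are i.i.d. complex Gaussian random variables distributed as $N(0,1)+iN(0,1)$. Let $x_0\in\mathbb{C}^n$ be nonzero, $y=A^*x_0$ and $b=|y|$ (entrywise modulus, $b(j)=|a_j^*x_0|$). Let $I\subset\{1,\dots,N\}$ with complement $I_c$ be such that $b(i)\le b(j)$ for all $i\in I$, $j\in I_c$, let $A_I$ be the $n\times|I|$ submatrix of $A$ with columns $\{a_i\}_{i\in I}$, and let \[ x_{\rm null}\in\arg\min\{\|A_I^*x\|^2: x\in\mathbb{C}^n,\ \|x\|=\|x_0\|\}. \] Suppose \[ \sigma:=\frac{|I|}{N}<1,\qquad \nu:=\frac{n}{|I|}<1 . \] Then for any $\epsilon\in(0,1)$, $\delta>0$ and $t\in(0,\nu^{-1/2}-1)$ the error bound \[ \|x_0x_0^*-x_{\rm null}x_{\rm null}^*\|^2\le\left(\left(\frac{2+t}{1-\epsilon}\right)\sigma+\epsilon\left(-2\ln(1-\sigma)+\delta\right)\right)\frac{2\|x_0\|^4}{\left(1-(1+t)\sqrt{\nu}\right)^2} \] holds with probability at least \[ 1-2\exp\left(-N\delta^2e^{-\delta}|1-\sigma|^2/2\right)-\exp\left(-2\lfloor|I|\epsilon\rfloor^2/N\right)-Q, \] where $Q$ has the asymptotic upper bound \[ 2\exp\left\{-c\min\left[\frac{e^2t^2}{16}\left(\ln\sigma^{-1}\right)^2\frac{|I|^2}{N},\ \frac{et}{4}|I|\ln\sigma^{-1}\right]\right\},\qquad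 \sigma\ll 1, \] with an absolute constant $c$.
   Context: $\|\cdot\|$ denotes the Euclidean norm on vectors and the Frobenius norm on matrices, so that $\|x_0x_0^*-x_{\rm null}x_{\rm null}^*\|^2=2\|x_0\|^4-2|x_0^*x_{\rm null}|^2$. $A^*$ denotes the conjugate transpose. The vector $x_{\rm null}$ (the ''null vector'') is a singular vector of $A_I^*$ for its least singular value, normalized to have norm $\|x_0\|$; it is defined only up to a global phase factor, and the error metric is independent of that phase. *)

(* Defs.v *)
From HB Require Import structures.
From mathcomp Require Import all_boot all_order all_algebra.
From mathcomp Require Import all_classical all_reals all_analysis.
Set Implicit Arguments. Unset Strict Implicit. Unset Printing Implicit Defensive.
Import Order.TTheory GRing.Theory Num.Theory.
Local Open Scope classical_set_scope.
Local Open Scope ring_scope.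

(* Complex numbers are represented by their (real part, imaginary part).
   A complex vector of C^n is a pair (real parts, imaginary parts). *)
Definition cvec (R : realType) (n : nat) : Type := (('I_n -> R) * ('I_n -> R))%type.

Definition cnorm2 (R : realType) n (x : cvec R n) : R :=
  \sum_(k < n) (x.1 k ^+ 2 + x.2 k ^+ 2).

(* |a^* x|^2 for a column a = ar + i ai and x = x.1 + i x.2:
   a^* x = sum_k conj(a_k) x_k
         = sum_k (ar_k x1_k + ai_k x2_k) + i sum_k (ar_k x2_k - ai_k x1_k). *)
Definition cdot_abs2 (R : realType) n (ar ai : 'I_n -> R) (x : cvec R n) : R :=
  (\sum_(k < n) (ar k * x.1 k + ai k * x.2 k)) ^+ 2
  + (\sum_(k < n) (ar k * x.2 k - ai k * x.1 k)) ^+ 2.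

(* Squared Frobenius norm ||x x^* - y y^*||^2 = sum_{k,l} |x_k conj(x_l) - y_k conj(y_l)|^2,
   where x_k conj(x_l) = (x1_k x1_l + x2_k x2_l) + i (x2_k x1_l - x1_k x2_l). *)
Definition frob2_rank1_diff (R : realType) n (x y : cvec R n) : R :=
  \sum_(k < n) \sum_(l < n)
    ((x.1 k * x.1 l + x.2 k * x.2 l - (y.1 k * y.1 l + y.2 k * y.2 l)) ^+ 2
     + (x.2 k * x.1 l - x.1 k * x.2 l - (y.2 k * y.1 l - y.1 k * y.2 l)) ^+ 2).

(* Mutual independence of a finite family of real random variables:
   product rule for all measurable sets (taking B i = setT gives every subfamily). *)
Definition mutual_indep d (T : measurableType d) (R : realType)
    (P : probability T R) (I : finType) (X : I -> T -> R) : Prop :=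
  forall B : I -> set R, (forall i, measurable (B i)) ->
    P (\bigcap_(i in [set: I]) (X i @^-1` B i)) = (\prod_(i : I) P (X i @^-1` B i))%E.

(* Random matrix A in C^{n x N}: A k j = X (k,j,false) + i X (k,j,true). *)
Definition colre (R : realType) (T : Type) n N (X : 'I_n * 'I_N * bool -> T -> R)
  (w : T) (j : 'I_N) : 'I_n -> R := fun k => X (k, j, false) w.
Definition colim (R : realType) (T : Type) n N (X : 'I_n * 'I_N * bool -> T -> R)
  (w : T) (j : 'I_N) : 'I_n -> R := fun k => X (k, j, true) w.

Definition bvec (R : realType) (T : Type) n N (X : 'I_n * 'I_N * bool -> T -> R)
  (x0 : cvec R n) (w : T) (j : 'I_N) : R :=
  Num.sqrt (cdot_abs2 (colre X w j) (colim X w j) x0).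

Definition objI (R : realType) (T : Type) n N (X : 'I_n * 'I_N * bool -> T -> R)
  (I : {set 'I_N}) (w : T) (x : cvec R n) : R :=
  \sum_(j in I) cdot_abs2 (colre X w j) (colim X w j) x.

(* Main.v *)
Require Import Defs.
From HB Require Import structures.
From mathcomp Require Import all_boot all_order all_algebra.
From mathcomp Require Import all_classical all_reals all_analysis.
From mathcomp Require Import measurable_realfun.
From mathcomp Require Import ring lra.
Import Order.TTheory GRing.Theory Num.Theory.
Import numFieldNormedType.Exports.
Set Implicit Arguments. Unset Strict Implicit. Unset Printing Implicit Defensive.
Local Open Scope classical_set_scope.
Local Open Scope ring_scope.

(* Let rho = |x0|^2, sigma = m/N, eta = 1 - sqrt(n/m), and let e be the least value of
   |A_I^* u|^2 / |u|^2 over u orthogonal to x0.  Rotate the phase of x so that x0^* x >= 0,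
   and let z, u be the components of x0 and x orthogonal to x and x0 respectively.
   Stationarity of x makes x and z orthogonal for the form |A_I^* .|^2, hence
   e |u|^2 <= |A_I^* u|^2 <= |A_I^* z|^2 <= |A_I^* x0|^2, that is,
   ||x0 x0^* - x x^*||^2 <= 2 rho |A_I^* x0|^2 / e.

   In a unitary frame whose first vector is x0/|x0|, the intensities b(j)^2 depend on the
   first row of A only.  They are multiples of independent exponential variables; by a
   Chernoff bound at least m of the N are below 2.04 sigma rho outside an event of
   probability exp(-m/50000), so that |A_I^* x0|^2 <= 2.04 sigma m rho.  Ties having
   probability zero, I is a function of the first row, and the remaining rows restricted to
   I form an (n-1) x m Gaussian matrix G independent of I.

   The lower tail of the least eigenvalue e of W = G G^* is obtained from a further
   independent Gaussian column h.  If e < y then h^* W^-1 h > s has conditional probability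
   at least exp(-s y / 2).  If instead h is fixed and rotated to an axis, h^* W^-1 h > s says
   that one Gaussian row is within distance |h|/sqrt(s) of the span of the others, and the
   squared distance is a chi-square variable.  With s = 2/eta this gives e >= 1.02 eta^2 m
   outside an event of probability exp(-0.03 eta m), and then
   ||x0 x0^* - x x^*||^2 <= 4 sigma rho^2 / eta^2, which is below the claimed bound.  For
   small sigma the two exceptional probabilities are absorbed by the second exponential and
   by Q, unless Q >= 1. *)

(** * The law of a pair of independent standard Gaussians *)

Section lebesgue_affine.
Variable R : realType.
Notation mu := (@lebesgue_measure R).

(** The image of Lebesgue measure under the shift gives half-open intervals their length, and this
    determines the measure. *)
Lemma lebesgue_integral_translate (a : R) (f : R -> \bar R) :
  measurable_fun [set: R] f -> (forall x, 0 <= f x)%E ->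
  (\int[mu]_x f (x + a)%R = \int[mu]_x f x)%E.
Proof.
move=> mf f0.
have mphi : measurable_fun setT (fun x : measurableTypeR R => (x + a : measurableTypeR R)).
  by apply: measurable_funD.
have := @ge0_integral_pushforward _ _ _ _ R _ mphi mu setT f measurableT mf (fun y _ => f0 y).
rewrite preimage_setT => <-.
apply: eq_measure_integral => A mA _.
apply/esym/lebesgue_measure_unique => //= _ [[u v]] _ <-.
rewrite /pushforward.
have -> : (fun x : R => x + a) @^-1` `]u, v] = `](u - a), (v - a)]%classic.
  by apply/seteqP; split=> x /=; rewrite !in_itv/= lerBrDr ltrBlDr.
rewrite !lebesgue_measure_itv/= !lte_fin ltrD2r.
by case: ifP => // _; rewrite -!EFinB; congr EFin; ring.
Qed.

Lemma lebesgue_integral_scale (c : R) (f : R -> \bar R) : c != 0 ->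
  measurable_fun [set: R] f -> (forall x, 0 <= f x)%E ->
  (\int[mu]_x f x = `|c|%:E * \int[mu]_x f (c * x)%R)%E.
Proof.
move=> c0 mf f0.
pose phi := fun x : measurableTypeR R => (c * x : measurableTypeR R).
have mphi : measurable_fun setT phi by apply: measurable_funM.
have := @ge0_integral_pushforward _ _ _ _ R _ mphi mu setT f measurableT mf (fun y _ => f0 y).
rewrite preimage_setT => E.
transitivity (`|c|%:E * \int[mu]_x (f \o phi) x)%E; last by [].
pose nc : {nonneg R} := NngNum (normr_ge0 c).
rewrite -E -(ge0_integral_mscale (pushforward mu phi) measurableT nc)//.
apply: eq_measure_integral => A mA _.
apply/lebesgue_measure_unique => //= _ [[u v]] _ <-.
rewrite /mscale/= /pushforward.
have [cgt|clt|c0'] := ltgtP 0 c; last by rewrite -c0' eqxx in c0.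
- have -> : phi @^-1` `]u, v] = `](u / c), (v / c)]%classic.
    by apply/seteqP; split=> x /=; rewrite !in_itv/= ltr_pdivrMr// ler_pdivlMr// /phi mulrC.
  rewrite !lebesgue_measure_itv/= !lte_fin ltr_pM2r ?invr_gt0//.
  case: ifP => // _; last by rewrite mule0.
  by rewrite -!EFinB -EFinM gtr0_norm//; congr EFin; field.
(* A negative factor swaps the open and the closed end, which does not affect the length. *)
- have -> : phi @^-1` `]u, v] = `[(v / c), (u / c)[%classic.
    by apply/seteqP; split=> x /=; rewrite !in_itv/= ler_ndivrMr// ltr_ndivlMr// andbC /phi mulrC.
  rewrite !lebesgue_measure_itv/= !lte_fin ltr_nM2r ?invr_lt0//.
  case: ifP => // _; last by rewrite mule0.
  by rewrite -!EFinB -EFinM ltr0_norm//; congr EFin; field.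
Qed.

End lebesgue_affine.

Section product_sections.
Context d1 d2 (T1 : measurableType d1) (T2 : measurableType d2) (R : realType).
Variables (m1 : {sigma_finite_measure set T1 -> \bar R})
          (m2 : {sigma_finite_measure set T2 -> \bar R}).

Lemma product_measure_xsectionE (A : set (T1 * T2)) :
  ((m1 \x m2) A = \int[m1]_x m2 [set y | A (x, y)])%E.
Proof.
apply: eq_integral => x _ /=; congr (m2 _).
by apply/seteqP; split=> y; rewrite /xsection/= inE.
Qed.

End product_sections.

Section gaussian_pair.
Variable R : realType.
Notation mu := (@lebesgue_measure R).
Notation g := (@normal_pdf R 0 1).
Notation gam := (@normal_prob R 0 1).

(** The Radon-Nikodym derivative of the Gaussian measure agrees almost everywhere with [normal_pdf],
    since both have the same integral over every measurable set. *)
Lemma ge0_integral_normal_prob (f : R -> \bar R) :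
  measurable_fun [set: R] f -> (forall x, 0 <= f x)%E ->
  (\int[gam]_x f x = \int[mu]_x (f x * (g x)%:E))%E.
Proof.
move=> mf f0.
have dom := @normal_prob_dominates R 0 1.
rewrite -(Radon_Nikodym_SigmaFinite.change_of_variables dom)//.
apply: ae_eq_integral => //.
- apply: emeasurable_funM => //.
  exact: measurable_int (Radon_Nikodym_SigmaFinite.f_integrable dom).
- apply: emeasurable_funM => //; apply/measurable_EFinP.
  exact: measurable_normal_pdf.
- apply: ae_eqe_mul2l; apply: integral_ae_eq => //.
  + exact: Radon_Nikodym_SigmaFinite.f_integrable.
  + by apply/measurable_EFinP; exact: measurable_normal_pdf.
  + by move=> A _ mA; rewrite -(Radon_Nikodym_SigmaFinite.f_integral dom).
Qed.

(** A plane rotation is a composite of three shears, and a shear is a translation on every line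
    where the other coordinate is fixed. The shear coefficient [a] is the tangent of half the angle,
    hence the condition on [s]. *)
Lemma integral2_rotation (c s : R) (F : R * R -> \bar R) :
  c ^+ 2 + s ^+ 2 = 1 -> s != 0 ->
  measurable_fun [set: R * R] F -> (forall x, 0 <= F x)%E ->
  (\int[mu]_x \int[mu]_y F (c * x + s * y, - s * x + c * y)%R
   = \int[mu]_x \int[mu]_y F (x, y))%E.
Proof.
move=> cs s0 mF F0.
pose a := (1 - c) / s.
have mF1 (u v u' v' : R) : measurable_fun [set: R * R]
    (fun p => F (u * p.1 + v * p.2, u' * p.1 + v' * p.2)).
  apply: measurableT_comp => //; apply/measurable_fun_pairP; split.
    by apply: measurable_funD; apply: measurable_funM => //; apply: measurable_cst.
  by apply: measurable_funD; apply: measurable_funM => //; apply: measurable_cst.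
have sh1 (G : R * R -> \bar R) (b : R) : measurable_fun [set: R * R] G ->
    (forall x, 0 <= G x)%E ->
    (\int[mu]_x \int[mu]_y G (x, y + b * x)%R = \int[mu]_x \int[mu]_y G (x, y))%E.
  move=> mG G0; apply: eq_integral => x _.
  apply: (lebesgue_integral_translate (b * x) (f := fun y => G (x, y))) => //.
  exact: measurableT_comp.
(* This shear moves the outer variable, so Tonelli exchanges the integrals first. *)
have sh2 (G : R * R -> \bar R) (b : R) : measurable_fun [set: R * R] G ->
    measurable_fun [set: R * R] (fun p => G (p.1 + b * p.2, p.2)) ->
    (forall x, 0 <= G x)%E ->
    (\int[mu]_x \int[mu]_y G (x + b * y, y)%R = \int[mu]_x \int[mu]_y G (x, y))%E.
  move=> mG mG' G0.
  have -> := @fubini_tonelli _ _ _ _ R mu mu (fun p : R * R => G (p.1 + b * p.2, p.2)%R) mG' (fun p => G0 _).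
  have -> := @fubini_tonelli _ _ _ _ R mu mu G mG G0.
  apply: eq_integral => y _.
  apply: (lebesgue_integral_translate (b * y) (f := fun x => G (x, y))) => //.
  exact: measurableT_comp.
have mE (u v u' v' : R) (H : R * R -> \bar R) :
    (forall p, H p = F (u * p.1 + v * p.2, u' * p.1 + v' * p.2)) ->
    measurable_fun [set: R * R] H.
  by move=> HE; rewrite (_ : H = (fun p => F (u * p.1 + v * p.2, u' * p.1 + v' * p.2)));
    [exact: mF1|exact/funext].
have m1 : measurable_fun [set: R * R] (fun p : R * R => F (p.1 + a * p.2, p.2)).
  by apply: (mE 1 a 0 1) => p; congr (F (_, _)); ring.
have m2 : measurable_fun [set: R * R] (fun p : R * R =>
    F (p.1 + a * (p.2 + - s * p.1), p.2 + - s * p.1)).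
  by apply: (mE (1 - a * s) a (- s) 1) => p /=; congr (F (_, _)); ring.
have m3 : measurable_fun [set: R * R] (fun p : R * R =>
    F (p.1 + a * p.2 + a * (p.2 + - s * (p.1 + a * p.2)), p.2 + - s * (p.1 + a * p.2))).
  by apply: (mE (1 - a * s) (a + a * (1 - s * a)) (- s) (1 - s * a)) => p /=;
    congr (F (_, _)); ring.
have h1 := sh2 F a mF m1 F0.
have h2 := sh1 _ (- s) m1 (fun p => F0 _).
have h3 := sh2 _ a m2 m3 (fun p => F0 _).
etransitivity; last exact: h1.
etransitivity; last exact: h2.
etransitivity; last exact: h3.
apply: eq_integral => x _; apply: eq_integral => y _ /=.
have c2 : c ^+ 2 = 1 - s ^+ 2 by rewrite -cs addrK.
congr (F (_, _)); rewrite /a; last by field.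
rewrite -[LHS](mulfK s0) -[RHS](mulfK s0); congr (_ / _).
have -> : (x + (1 - c) / s * y + (1 - c) / s * (y + - s * (x + (1 - c) / s * y))) * s
  = x * s + (1-c) * y + (1 - c) * y - (1 - c) * s * x - (1 - c) * (1-c) * y by field.
have -> : (c * x + s * y) * s = c * x * s + (1 - c ^+ 2) * y by rewrite c2; ring.
ring.
Qed.

Lemma normal_pdf01E x : g x = normal_peak 1 * expR (- (x ^+ 2) / 2).
Proof.
by rewrite normal_pdfE ?oner_eq0// /normal_fun subr0 expr1n.
Qed.

Lemma normal_pdfM_norm (x y x' y' : R) : x ^+ 2 + y ^+ 2 = x' ^+ 2 + y' ^+ 2 ->
  g x * g y = g x' * g y'.
Proof.
move=> E; rewrite !normal_pdf01E mulrACA -expRD [RHS]mulrACA -expRD.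
by congr (_ * expR _); rewrite -!mulrDl -!opprD E.
Qed.

Lemma ge0_integral_normal_pair (F : R * R -> \bar R) :
  measurable_fun [set: R * R] F -> (forall x, 0 <= F x)%E ->
  (\int[gam]_x \int[gam]_y F (x, y)
   = \int[mu]_x \int[mu]_y (F (x, y) * (g x * g y)%:E))%E.
Proof.
move=> mF F0.
have mg : measurable_fun [set: R] (EFin \o g).
  by apply/measurable_EFinP; exact: measurable_normal_pdf.
rewrite ge0_integral_normal_prob//; last first.
- by move=> x; apply: integral_ge0.
- exact: (@measurable_fun_fubini_tonelli_F _ _ _ _ R gam F mF F0).
apply: eq_integral => x _.
have mFx : measurable_fun [set: R] (fun y => F (x, y)) by exact: measurableT_comp.
rewrite ge0_integral_normal_prob//.
rewrite -ge0_integralZr//.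
- by apply: eq_integral => y _; rewrite EFinM -muleA [X in (_ * X)%E]muleC.
- exact: emeasurable_funM.
- by move=> y _; rewrite mule_ge0// lee_fin normal_pdf_ge0.
- by rewrite lee_fin normal_pdf_ge0.
Qed.

Lemma normal_pairE (A : set (R * R)) : measurable A ->
  ((gam \x gam) A = \int[mu]_x \int[mu]_y ((\1_A (x, y))%:E * (g x * g y)%:E))%E.
Proof.
move=> mA.
have mF : measurable_fun [set: R * R] (fun p => (\1_A p)%:E : \bar R).
  by apply/measurable_EFinP; exact: measurable_indic.
have F0 p : (0 <= (\1_A p)%:E :> \bar R)%E by rewrite lee_fin.
etransitivity; last exact: (ge0_integral_normal_pair mF F0).
apply: eq_integral => x _ /=.
exact: (congr1 (@^~ x) (esym (indic_fubini_tonelli_FE gam mA))).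
Qed.

(** Lebesgue measure is invariant under the rotation, and the joint density depends on the norm
    alone. *)
Lemma normal_pair_rotation (c s : R) (D : set (R * R)) :
  c ^+ 2 + s ^+ 2 = 1 -> s != 0 -> measurable D ->
  (gam \x gam)%E [set p : R * R | D (c * p.1 + s * p.2, - s * p.1 + c * p.2)]
   = (gam \x gam)%E D.
Proof.
move=> cs s0 mD.
have mphi : measurable_fun [set: R * R]
    (fun p : R * R => (c * p.1 + s * p.2, - s * p.1 + c * p.2)).
  apply/measurable_fun_pairP; split;
    by apply: measurable_funD; apply: measurable_funM => //; apply: measurable_cst.
have mD' : measurable [set p : R * R | D (c * p.1 + s * p.2, - s * p.1 + c * p.2)].
  by rewrite -[X in measurable X]setTI; exact: mphi.
rewrite (normal_pairE mD) (normal_pairE mD').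
have mF : measurable_fun [set: R * R]
    (fun p : R * R => (\1_D p)%:E * (g p.1 * g p.2)%:E)%E.
  apply: emeasurable_funM.
    by apply/measurable_EFinP; exact: measurable_indic.
  by apply/measurable_EFinP; apply: measurable_funM;
    apply: measurableT_comp => //; exact: measurable_normal_pdf.
have F0 (p : R * R) : (0 <= (\1_D p)%:E * (g p.1 * g p.2)%:E)%E.
  by rewrite mule_ge0// lee_fin// mulr_ge0// normal_pdf_ge0.
etransitivity; last exact: (integral2_rotation cs s0 mF F0).
apply: eq_integral => x _; apply: eq_integral => y _ /=; congr (_ * _%:E)%E.
apply: normal_pdfM_norm.
have c2 : c ^+ 2 = 1 - s ^+ 2 by rewrite -cs addrK.
transitivity ((c ^+ 2 + s ^+ 2) * (x ^+ 2 + y ^+ 2)); last by ring.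
by rewrite cs mul1r.
Qed.

End gaussian_pair.

(** * The radial law of a Gaussian pair and the Gaussian Laplace transform *)

Section gaussian_radial.
Variable R : realType.
Notation mu := (@lebesgue_measure R).
Notation g := (@normal_pdf R 0 1).
Notation gam := (@normal_prob R 0 1).

Let rf (w x : R) : R := x * expR (- (w * x ^+ 2) / 2).

Let rF (w x : R) : R := - expR (- (w * x ^+ 2) / 2) / w.

Let is_derive_rF (w x : R) : w != 0 -> is_derive x 1 (rF w) (rf w x).
Proof.
move=> w0.
have h2 : is_derive x 1 (fun x : R => - (w * x ^+ 2) / 2) (- (w * x)).
  have -> : (fun x : R => - (w * x ^+ 2) / 2) = (- (w / 2)) \*: (@GRing.exp R ^~ 2).
    by apply/funext => y /=; rewrite /GRing.scale/=; field.
  apply: is_derive_eq; rewrite -[LHS]/(- (w / 2) * (x * 1 + x * 1)); by field.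
have h3 := is_derive1_comp (is_derive_expR _) h2.
have -> : rF w = (- w^-1) \*: (expR \o (fun x : R => - (w * x ^+ 2) / 2)).
  by apply/funext => y; rewrite -[RHS]/(- w^-1 * _) /rF mulNr [RHS]mulNr [in RHS]mulrC.
apply: is_derive_eq; rewrite -[LHS]/(- w^-1 * (expR _ * - (w * x))) /rf.
by field.
Qed.

Let cont_quad (w : R) : continuous (fun x : R => - (w * x ^+ 2) / 2).
Proof.
move=> x; apply: cvgM; last exact: cvg_cst.
apply: (@cvgN _ R^o); apply: cvgM; first exact: cvg_cst.
exact: exprn_continuous.
Qed.

Let cont_gauss (w : R) : continuous (fun x : R => expR (- (w * x ^+ 2) / 2)).
Proof.
move=> x; apply: continuous_comp; first exact: cont_quad.
exact: continuous_expR.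
Qed.

Let cont_rf (w : R) : continuous (rf w).
Proof. by move=> x; apply: cvgM; [exact: cvg_id|exact: cont_gauss]. Qed.

Let integral_rf (w a : R) : 0 < w -> 0 <= a ->
  (\int[mu]_(x in `[a, +oo[) (rf w x)%:E = (expR (- (w * a ^+ 2) / 2) / w)%:E)%E.
Proof.
move=> w0 a0.
rewrite (@ge0_continuous_FTC2y R (rf w) (rF w) a 0).
- by rewrite -EFinB sub0r /rF mulNr opprK.
- by move=> x ax; rewrite mulr_ge0 ?expR_ge0// (le_trans a0).
- by apply: continuous_subspaceT => x; exact: cont_rf.
- have -> : rF w = (fun x => (- w^-1) * expR (- (w * x ^+ 2) / 2)).
    by apply/funext => x; rewrite /rF mulNr [RHS]mulNr [in RHS]mulrC.
  rewrite -[X in _ --> X](mulr0 (- w^-1)); apply: cvgM; first exact: cvg_cst.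
  have -> : (fun x : R => expR (- (w * x ^+ 2) / 2)) =
     (fun y => expR (- y)) \o (fun x => w / 2 * x ^+ 2).
    by apply/funext => x /=; congr expR; field.
  apply: (@cvg_comp _ _ _ (fun x : R => w / 2 * x ^+ 2) (fun y => expR (- y)) _ (+oo)%R); last exact: cvgr_expR.
  apply: gt0_cvgMry; first exact: divr_gt0.
  exact: cvgr_expr2.
- by move=> x _; apply: ex_derive; apply: is_derive_rF; rewrite gt_eqF.
- apply: cvg_at_right_filter.
  apply: cvgM; last exact: cvg_cst.
  by apply: (@cvgN _ R^o); exact: cont_gauss.
- by move=> x _; rewrite derive1E; apply: derive_val; apply: is_derive_rF; rewrite gt_eqF.
Qed.

(** Up to a constant, the integrand along the line of slope [v], with [w = 1 + v ^+ 2]; the factor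
    [|x|] is the Jacobian of [(x, v) |-> (x, x * v)]. *)
Let Jf (w z x : R) : R :=
  `|x| * (\1_[set x : R | 2 * z <= w * x ^+ 2] x * expR (- (w * x ^+ 2) / 2)).

Let meas_quad_set (w z : R) : measurable [set x : R | 2 * z <= w * x ^+ 2].
Proof.
have -> : [set x : R | 2 * z <= w * x ^+ 2]
    = [set: R] `&` (fun x => w * x ^+ 2) @^-1` `[2 * z, +oo[.
  by apply/seteqP; split=> x /=; rewrite in_itv/= andbT; [|case].
have mf : measurable_fun [set: R] (fun x : R => w * x ^+ 2).
  apply: measurable_funM; first exact: measurable_cst.
  exact: exprn_measurable.
exact: mf.
Qed.

Let meas_Jf (w z : R) : measurable_fun [set: R] (Jf w z).
Proof.
apply: measurable_funM; first exact: normr_measurable.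
apply: measurable_funM; first by apply: measurable_indic; exact: meas_quad_set.
apply: continuous_measurable_fun; exact: cont_gauss.
Qed.

Let integral_Jf (w z : R) : 0 < w -> 0 <= z ->
  (\int[mu]_x (Jf w z x)%:E = (2 * (expR (- z) / w))%:E)%E.
Proof.
move=> w0 z0.
pose a := Num.sqrt (2 * z / w).
have a0 : 0 <= a by exact: sqrtr_ge0.
have a2 : w * a ^+ 2 = 2 * z.
  by rewrite sqr_sqrtr ?divr_ge0 ?mulr_ge0 ?(ltW w0)//; field; rewrite gt_eqF.
pose hp (x : R) : \bar R := ((EFin \o rf w) \_ `[a, +oo[) x.
have mrf : measurable_fun [set: R] (EFin \o rf w).
  by apply/measurable_EFinP; apply: continuous_measurable_fun; exact: cont_rf.
have mhp : measurable_fun [set: R] hp.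
  by apply/(measurable_restrictT _ _).1 => //; exact: measurable_funTS.
have hp0 x : (0 <= hp x)%E.
  rewrite /hp patchE; case: ifPn => //; rewrite inE/= in_itv/= andbT => ax.
  by rewrite lee_fin mulr_ge0 ?expR_ge0// (le_trans a0).
have hpI : (\int[mu]_x hp x = (expR (- z) / w)%:E)%E.
  transitivity (\int[mu]_(x in `[a, +oo[) (rf w x)%:E)%E.
    by rewrite [RHS]integral_mkcond.
  rewrite integral_rf// a2.
  by congr (expR _ / _)%:E; field.
have hpN : (\int[mu]_x hp (- 1 * x)%R = (expR (- z) / w)%:E)%E.
  have N1 : (-1 : R) != 0 by rewrite oppr_eq0 oner_eq0.
  by rewrite -hpI [RHS](lebesgue_integral_scale N1 mhp hp0) normrN1 mul1e.
have JE x : (Jf w z x)%:E = (hp x + hp (- 1 * x)%R)%E.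
  have key y : 0 <= y -> 2 * z <= w * y ^+ 2 = (a <= y).
    by move=> y0; rewrite -a2 ler_pM2l// ler_sqr ?nnegrE.
  have indE : \1_[set x : R | 2 * z <= w * x ^+ 2] x = (nat_of_bool (2 * z <= w * x ^+ 2)%R)%:R :> R.
    by rewrite indicE; congr (nat_of_bool _)%:R; apply/idP/idP; rewrite inE.
  rewrite /Jf /hp !patchE indE !mem_setE /rf/= !in_itv/= !andbT mulN1r.
  have [x0|x0|<-] := ltgtP 0 x.
  - rewrite (gtr0_norm x0) key ?(ltW x0)//.
    have -> : (a <= - x) = false.
      by apply/negbTE; rewrite -ltNge (lt_le_trans _ a0)// oppr_lt0.
    by rewrite adde0; case: (a <= x); rewrite ?mul1r// mul0r mulr0.
  - rewrite (ltr0_norm x0) -sqrrN key ?oppr_ge0 ?(ltW x0)//.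
    have -> : (a <= x) = false by apply/negbTE; rewrite -ltNge (lt_le_trans x0).
    by rewrite add0e; case: (a <= - x); rewrite ?mul1r// mul0r mulr0.
  - by rewrite normr0 !mul0r oppr0 mul0r; case: ifP => _; rewrite adde0.
under eq_integral do rewrite JE.
rewrite ge0_integralD//.
- by rewrite hpI hpN -EFinD; congr EFin; ring.
- apply: (measurableT_comp mhp); apply: measurable_funM => //.
Qed.

(** Slopes replace polar coordinates: with [y = x * v] the integral in [x] is elementary and leaves
    [expR (- z)] times an integral [C] over [v] that does not involve [z]. The case [z = 0] gives
    [C = 1]. *)
Lemma normal_pair_radial (z : R) : 0 <= z ->
  (gam \x gam)%E [set p : R * R | 2 * z <= p.1 ^+ 2 + p.2 ^+ 2] = (expR (- z))%:E.
Proof.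
pose K : R := normal_peak 1 ^+ 2.
have K0 : 0 <= K by rewrite sqr_ge0.
pose C := (\int[mu]_v (K * 2 / (1 + v ^+ 2))%:E)%E.
have mC : measurable_fun [set: R] (fun v : R => (K * 2 / (1 + v ^+ 2))%:E).
  apply/measurable_EFinP; apply: continuous_measurable_fun => v.
  apply: cvgM; first exact: cvg_cst.
  apply: cvgV; first by rewrite gt_eqF// ltr_wpDr// sqr_ge0.
  by apply: cvgD; [exact: cvg_cst|exact: exprn_continuous].
pose D (z : R) := [set p : R * R | 2 * z <= p.1 ^+ 2 + p.2 ^+ 2].
have mD y : measurable (D y).
  have -> : D y = [set: R * R] `&` (fun p : R * R => p.1 ^+ 2 + p.2 ^+ 2) @^-1` `[2 * y, +oo[.
    by apply/seteqP; split=> x /=; rewrite in_itv/= andbT; [|case].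
  have mf : measurable_fun [set: R * R] (fun p : R * R => p.1 ^+ 2 + p.2 ^+ 2).
    by apply: measurable_funD; apply: measurable_funX.
  exact: mf.
have main y : 0 <= y -> ((gam \x gam) (D y) = (expR (- y))%:E * C)%E.
  move=> y0.
  pose H (p : R * R) : \bar R := ((\1_(D y) p)%:E * (g p.1 * g p.2)%:E)%E.
  have mH : measurable_fun [set: R * R] H.
    apply: emeasurable_funM.
      by apply/measurable_EFinP; exact: measurable_indic.
    by apply/measurable_EFinP; apply: measurable_funM;
      apply: measurableT_comp => //; exact: measurable_normal_pdf.
  have H0 p : (0 <= H p)%E.
    by rewrite mule_ge0// lee_fin// mulr_ge0// normal_pdf_ge0.
  pose H' (p : R * R) : \bar R := (`|p.1|%R%:E * H (p.1, (p.1 * p.2)%R))%E.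
  have mH' : measurable_fun [set: R * R] H'.
    apply: emeasurable_funM.
      by apply/measurable_EFinP; apply: measurableT_comp => //; exact: normr_measurable.
    apply: measurableT_comp => //; apply/measurable_fun_pairP; split; first exact: measurable_fst.
    by apply: measurable_funM.
  have H'0 p : (0 <= H' p)%E by rewrite mule_ge0.
  have HE v x : H' (x, v) = (K%:E * (Jf (1 + v ^+ 2) y x)%:E)%E.
    rewrite /H' /H/= -!EFinM; congr EFin.
    have -> : \1_(D y) (x, x * v) = \1_[set x : R | 2 * y <= (1 + v ^+ 2) * x ^+ 2] x :> R.
      rewrite !indicE; congr (nat_of_bool _)%:R.
      have e : (1 + v ^+ 2) * x ^+ 2 = x ^+ 2 + (x * v) ^+ 2 by ring.
      by apply/idP/idP; rewrite !inE /D/= e.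
    rewrite /Jf !normal_pdf01E.
    have -> : expR (- ((1 + v ^+ 2) * x ^+ 2) / 2)
        = expR (- (x ^+ 2) / 2) * expR (- (x * v) ^+ 2 / 2).
      by rewrite -expRD; congr expR; field.
    by rewrite /K; ring.
  rewrite normal_pairE//.
  transitivity (\int[mu]_x \int[mu]_v H' (x, v))%E.
    have mF1 := @measurable_fun_fubini_tonelli_F _ _ _ _ R mu H mH H0.
    have mF2 := @measurable_fun_fubini_tonelli_F _ _ _ _ R mu H' mH' H'0.
    apply: ge0_ae_eq_integral => //.
    - by move=> x _; apply: integral_ge0 => v _; exact: H0.
    - by move=> x _; apply: integral_ge0 => v _; exact: H'0.
    (* The substitution [y = x * v] degenerates only at [x = 0], a null set. *)
    exists [set 0]; split => //; first exact: lebesgue_measure_set1.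
    move=> x /= nE; apply: contrapT => x0; apply: nE => _.
    have x0' : x != 0 by apply/eqP.
    have mHx : measurable_fun [set: R] (fun w => H (x, w)) by exact: measurableT_comp.
    rewrite -[LHS]/(\int[mu]_w H (x, w))%E (lebesgue_integral_scale x0' mHx)//.
    rewrite -ge0_integralZl//.
    by apply: (measurableT_comp mHx); apply: measurable_funM => //; exact: measurable_cst.
  have -> := @fubini_tonelli _ _ _ _ R mu mu H' mH' H'0.
  have f0 (v : R) : [set: R] v -> (0 <= (K * 2 / (1 + v ^+ 2))%:E)%E.
    by move=> _; rewrite lee_fin; apply: divr_ge0; [exact: mulr_ge0|rewrite addr_ge0 ?sqr_ge0].
  have k0 : (0 <= (expR (- y))%:E)%E by rewrite lee_fin expR_ge0.
  rewrite -(ge0_integralZl mu measurableT mC f0 k0).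
  apply: eq_integral => v _.
  have w0 : 0 < 1 + v ^+ 2 by rewrite ltr_wpDr// sqr_ge0.
  under eq_integral do rewrite HE.
  have J0 (x : R) : [set: R] x -> (0 <= (Jf (1 + v ^+ 2) y x)%:E)%E.
    by move=> _; rewrite lee_fin !mulr_ge0 ?expR_ge0.
  have mJ : measurable_fun [set: R] (fun x => (Jf (1 + v ^+ 2) y x)%:E).
    by apply/measurable_EFinP; exact: meas_Jf.
  rewrite (ge0_integralZl mu measurableT mJ J0)//.
  by rewrite integral_Jf// -!EFinM; congr EFin; field; rewrite gt_eqF.
have C1 : C = 1%E.
  have := main 0 (lexx _); rewrite oppr0 expR0 mul1e => <-.
  have -> : D 0 = [set: R * R].
    by apply/seteqP; split=> // p _; rewrite /D/= mulr0 addr_ge0 ?sqr_ge0.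
  exact: probability_setT.
by move=> z0; rewrite (main z z0) C1 mule1.
Qed.

(** Multiplying the density by the exponential gives [s] times a centred Gaussian density of
    standard deviation [s], which has total mass one. *)
Lemma normal_laplace (a : R) : - 1 < a ->
  (\int[gam]_x (expR (- (a * x ^+ 2) / 2))%:E = ((Num.sqrt (1 + a))^-1)%:E)%E.
Proof.
move=> a1.
have a0 : 0 < 1 + a by rewrite addrC -ltrBlDr sub0r.
pose s := (Num.sqrt (1 + a))^-1.
have s0 : 0 < s by rewrite invr_gt0 sqrtr_gt0.
have s2 : s ^+ 2 = (1 + a)^-1 by rewrite exprVn sqr_sqrtr// ltW.
have mE : measurable_fun [set: R] (fun x : R => (expR (- (a * x ^+ 2) / 2))%:E).
  by apply/measurable_EFinP; apply: continuous_measurable_fun; exact: cont_gauss.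
have E0 (x : R) : (0 <= (expR (- (a * x ^+ 2) / 2))%:E)%E by rewrite lee_fin expR_ge0.
rewrite (ge0_integral_normal_prob mE E0).
have E x : ((expR (- (a * x ^+ 2) / 2))%:E * (g x)%:E
            = s%:E * (normal_pdf 0 s x)%:E)%E.
  rewrite -!EFinM; congr EFin; rewrite normal_pdf01E normal_pdfE ?gt_eqF//.
  rewrite mulrCA -expRD /normal_fun subr0 s2 [RHS]mulrA; congr (_ * expR _); last first.
    by field; rewrite gt_eqF.
  rewrite /normal_peak expr1n mul1r -mulrnAr sqrtrM ?sqr_ge0// sqrtr_sqr gtr0_norm//.
  by rewrite invfM mulVKf// gt_eqF.
under eq_integral do rewrite E.
have mg : measurable_fun [set: R] (fun x : R => (normal_pdf 0 s x)%:E).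
  by apply/measurable_EFinP; exact: measurable_normal_pdf.
have g0 (x : R) : [set: R] x -> (0 <= (normal_pdf 0 s x)%:E)%E.
  by move=> _; rewrite lee_fin normal_pdf_ge0.
have s0' : (0 <= s%:E)%E by rewrite lee_fin ltW.
by rewrite (ge0_integralZl mu measurableT mg g0 s0') integral_normal_pdf mule1.
Qed.

End gaussian_radial.

(** * Independent Gaussian families *)

Definition cylinders (R : realType) (I : finType) : set (set (I -> R)) :=
  [set A | exists2 B : I -> set R, (forall i, measurable (B i))
    & A = [set x | forall i, B i (x i)]].

Notation rvec R I := (g_sigma_algebraType (@cylinders R I)).

Section rvec.
Variables (R : realType) (I : finType).

Lemma cylinders_setI : setI_closed (@cylinders R I).
Proof.
move=> _ _ [B mB ->] [C mC ->]; exists (fun i => B i `&` C i).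
  by move=> i; exact: measurableI.
by apply/seteqP; split=> x /=; [move=> [xB xC] i; split|move=> xBC; split=> i; have [] := xBC i].
Qed.

Lemma measurable_coord (i : I) : measurable_fun [set: rvec R I] (fun x : rvec R I => (x : I -> R) i).
Proof.
move=> _ B mB; rewrite setTI; apply: sub_sigma_algebra.
exists (fun j => if j == i then B else setT).
  by move=> j; case: ifP.
apply/seteqP; split=> x /=.
  by move=> xB j; case: eqP => // ->.
by move=> /(_ i); rewrite eqxx.
Qed.

Lemma measurable_rvec d (T : measurableType d) (X : I -> T -> R) :
  (forall i, measurable_fun [set: T] (X i)) ->
  measurable_fun [set: T] (fun w => (X ^~ w : rvec R I)).
Proof.
move=> mX.
apply: (@measurability _ _ T (rvec R I) setT _ (@cylinders R I)) => // _ [_ [B mB ->] <-].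
rewrite setTI.
have -> : (fun w => (X ^~ w : rvec R I)) @^-1` [set x | forall i, B i (x i)]
    = \bigcap_(i in [set: I]) (X i @^-1` B i).
  by apply/seteqP; split=> w /= h i; [move=> _; exact: h|exact: h].
apply: fin_bigcap_measurable; first exact: finite_finset.
by move=> i _; rewrite -[X in measurable X]setTI; exact: mX.
Qed.

End rvec.

(** One product formula over boxes carries both independence and the marginal laws; factors equal to
    the whole line recover every subfamily. *)
Definition iid_normal d (T : measurableType d) (R : realType) (P : probability T R)
    (I : finType) (X : I -> T -> R) : Prop :=
  (forall i, measurable_fun [set: T] (X i)) /\
  (forall B : I -> set R, (forall i, measurable (B i)) ->
    P [set w | forall i, B i (X i w)] = (\prod_i normal_prob 0 1 (B i))%E).

Section iid_normal.
Context d (T : measurableType d) (R : realType) (P : probability T R).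
Notation gam := (@normal_prob R 0 1).

Lemma iid_normal_of_indep (I : finType) (X : I -> T -> R) :
  (forall i, measurable_fun setT (X i)) -> mutual_indep P X ->
  (forall i (B : set R), measurable B -> P (X i @^-1` B) = gam B) ->
  iid_normal P X.
Proof.
move=> mX iX XN; split=> // B mB.
have -> : [set w | forall i, B i (X i w)] = \bigcap_(i in [set: I]) (X i @^-1` B i).
  by apply/seteqP; split=> w /= h i; [move=> _; exact: h|exact: h].
by rewrite iX//; apply: eq_bigr => i _; rewrite XN.
Qed.

(** A box over [J] becomes a box over [I] by putting the whole line off the image of [h]. This
    extracts rows, columns and blocks of the matrix. *)
Lemma iid_normal_sub (I J : finType) (h : J -> I) (X : I -> T -> R) :
  injective h -> iid_normal P X -> iid_normal P (fun j => X (h j)).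
Proof.
move=> hi [mX iX]; split=> // B mB.
pose C i := if [pick j | h j == i] is Some j then B j else setT.
have Ch j : C (h j) = B j.
  rewrite /C; case: pickP => [j' /eqP/hi -> //|/(_ j)]; by rewrite eqxx.
have mC i : measurable (C i) by rewrite /C; case: pickP.
have -> : [set w | forall j, B j (X (h j) w)] = [set w | forall i, C i (X i w)].
  apply/seteqP; split=> w /= H i.
    by rewrite /C; case: pickP => // j /eqP <-.
  by rewrite -Ch.
rewrite iX// (bigID (mem (codom h)))/= [X in (_ * X)%E]big1 ?mule1; last first.
  move=> i; rewrite /C; case: pickP => [j /eqP <-|_ _]; first by rewrite codom_f.
  exact: probability_setT.
rewrite -big_uniq/=; last first.
  by rewrite /codom/= map_inj_uniq ?enum_uniq.
by rewrite /image_mem big_map big_enum/=; apply: eq_bigr => j _; rewrite Ch.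
Qed.

Lemma iid_normal_marginal (I : finType) (X : I -> T -> R) i (B : set R) :
  iid_normal P X -> measurable B -> P (X i @^-1` B) = gam B.
Proof.
move=> [mX iX] mB.
have := iX (fun j => if j == i then B else setT).
rewrite (bigD1 i)//= eqxx big1 ?mule1; last first.
  by move=> j /negbTE ->; exact: probability_setT.
move=> <-; last by move=> j; case: ifP.
congr (P _); apply/seteqP; split=> w /=.
  by move=> H j; case: eqP => // ->.
by move=> /(_ i); rewrite eqxx.
Qed.

(** Two laws that agree on boxes, a class closed under intersection, agree on the generated
    sigma-algebra. The families may live on different spaces, so one can be replaced by a resampled
    copy. *)
Lemma iid_normal_law d' (T' : measurableType d') (P' : probability T' R) (I : finType)
    (X : I -> T -> R) (Y : I -> T' -> R) (F : set (rvec R I)) :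
  iid_normal P X -> iid_normal P' Y -> measurable F ->
  P [set w | F (X ^~ w)] = P' [set w | F (Y ^~ w)].
Proof.
move=> [mX iX] [mY iY] mF.
pose fX : T -> rvec R I := fun w => X ^~ w.
pose fY : T' -> rvec R I := fun w => Y ^~ w.
have mX' : measurable_fun [set: T] fX by exact: measurable_rvec.
have mY' : measurable_fun [set: T'] fY by exact: measurable_rvec.
pose X' : {mfun T >-> rvec R I} := HB.pack fX (isMeasurableFun.Build _ _ _ _ fX mX').
pose Y' : {mfun T' >-> rvec R I} := HB.pack fY (isMeasurableFun.Build _ _ _ _ fY mY').
rewrite -[LHS]/(distribution P X' F) -[RHS]/(distribution P' Y' F).
apply: (@measure_unique _ R (rvec R I) (@cylinders R I) (fun=> setT) _ _ _ _
  (distribution P X') (distribution P' Y')) => //.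
- exact: cylinders_setI.
- by move=> _; exists (fun=> setT) => //; apply/seteqP.
- by rewrite bigcup_const//; exists 0%N.
- move=> _ [B mB ->].
  by rewrite -[LHS]/(P [set w | forall i, B i (X i w)])
             -[RHS]/(P' [set w | forall i, B i (Y i w)]) iX// iY.
- move=> _; exact: le_lt_trans (probability_le1 _ measurableT) (ltry _).
Qed.

End iid_normal.

Section givens.
Context d (T : measurableType d) (R : realType).

Definition givens (I : finType) (i j : I) (c s : R) (x : I -> R) (l : I) : R :=
  if l == i then c * x i + s * x j else if l == j then - s * x i + c * x j else x l.

Lemma measurable_givens (I : finType) (i j : I) (c s : R) (X : I -> T -> R) l :
  (forall l, measurable_fun [set: T] (X l)) ->
  measurable_fun [set: T] (fun w => givens i j c s (X ^~ w) l).
Proof.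
move=> mX; rewrite /givens; case: (l == i); last case: (l == j) => //;
  by apply: measurable_funD; apply: measurable_funM => //; exact: measurable_cst.
Qed.

End givens.

Section decoupling.
Context d (T : measurableType d) (R : realType) (P : probability T R).
Notation gam := (@normal_prob R 0 1).

(** Resampling on [T * T]: coordinates in [A] are read from the first copy and the rest from the
    second. Conditioning on [A] then amounts to Fubini. *)
Definition splice (I : finType) (A : pred I) (X : I -> T -> R) (i : I) (w : T * T) : R :=
  if A i then X i w.1 else X i w.2.

Lemma measurable_splice (I : finType) (A : pred I) (X : I -> T -> R) i :
  measurable_fun [set: T] (X i) -> measurable_fun [set: T * T] (splice A X i).
Proof.
by move=> mX; rewrite /splice; case: (A i); exact: measurableT_comp.
Qed.

Lemma iid_normal_splice (I : finType) (A : pred I) (X : I -> T -> R) :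
  iid_normal P X -> iid_normal (P \x P)%E (splice A X).
Proof.
move=> [mX iX]; split; first by move=> i; exact: measurable_splice.
move=> B mB.
pose B1 i := if A i then B i else setT.
pose B2 i := if A i then setT else B i.
have mB1 i : measurable (B1 i) by rewrite /B1; case: ifP.
have mB2 i : measurable (B2 i) by rewrite /B2; case: ifP.
have mS (C : I -> set R) : (forall i, measurable (C i)) ->
    measurable [set w | forall i, C i (X i w)].
  move=> mC; have -> : [set w | forall i, C i (X i w)] = \bigcap_(i in [set: I]) (X i @^-1` C i).
    by apply/seteqP; split=> w /= h i; [move=> _; exact: h|exact: h].
  apply: fin_bigcap_measurable; first exact: finite_finset.
  by move=> i _; rewrite -[X in measurable X]setTI; exact: mX.
have -> : [set w | forall i, B i (splice A X i w)]
    = [set w | forall i, B1 i (X i w)] `*` [set w | forall i, B2 i (X i w)].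
  apply/seteqP; split=> w /=; rewrite /splice /B1 /B2.
    by move=> h; split=> i; have := h i; case: (A i).
  by move=> [h1 h2] i; have := h1 i; have := h2 i; case: (A i).
transitivity (P [set w | forall i, B1 i (X i w)] * P [set w | forall i, B2 i (X i w)])%E.
  exact: (product_measure1E P P (mS _ mB1) (mS _ mB2)).
rewrite !iX// -big_split/=; apply: eq_bigr => i _; rewrite /B1 /B2.
by case: (A i); rewrite probability_setT ?mule1 ?mul1e.
Qed.

Lemma iid_normal_decouple (I : finType) (A : pred I) (X : I -> T -> R) (F : set (rvec R I)) :
  iid_normal P X -> measurable F ->
  (P [set w | F (X ^~ w)]
   = \int[P]_w1 P [set w2 | F (fun i => if A i then X i w1 else X i w2)])%E.
Proof.
move=> iX mF; rewrite (iid_normal_law iX (iid_normal_splice A iX) mF).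
exact: (product_measure_xsectionE P P).
Qed.

Lemma iid_normal_pair (I : finType) (X : I -> T -> R) i j (D : set (R * R)) :
  i != j -> iid_normal P X -> measurable D ->
  P [set w | D (X i w, X j w)] = (gam \x gam)%E D.
Proof.
move=> ij iX mD.
have [mX _] := iX.
pose fX : T -> (measurableTypeR R * measurableTypeR R)%type := fun w => (X i w, X j w).
have mij : measurable_fun [set: T] fX.
  by apply/measurable_fun_pairP; split; [exact: (mX i)|exact: (mX j)].
pose Xij : {mfun T >-> (measurableTypeR R * measurableTypeR R)%type} :=
  HB.pack fX (isMeasurableFun.Build _ _ _ _ fX mij).
rewrite -[LHS]/(distribution P Xij D); apply/esym.
apply: product_measure_unique => // A B mA mB.
rewrite -[LHS]/(P [set w | A (X i w) /\ B (X j w)]).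
have h : injective (fun b : bool => if b then i else j).
  by case; case => //= e; move: ij; rewrite e eqxx.
have [_ /(_ (fun b => if b then A else B))] := iid_normal_sub h iX.
rewrite big_bool/= => <-; last by case.
by congr (P _); apply/seteqP; split=> w /=; [move=> [? ?] []|move=> H; split; [exact: (H true)|exact: (H false)]].
Qed.

(** Splicing separates the two rotated coordinates from the others; the pair is rotation invariant
    and the rest of the box is untouched. *)
Lemma iid_normal_givens (I : finType) (X : I -> T -> R) (i j : I) (c s : R) :
  i != j -> c ^+ 2 + s ^+ 2 = 1 -> s != 0 ->
  iid_normal P X -> iid_normal P (fun l w => givens i j c s (X ^~ w) l).
Proof.
move=> ij cs s0 iX; have [mX _] := iX.
split; first by move=> l; exact: measurable_givens.
move=> B mB.
pose D := [set p : R * R | (B i `*` B j) (c * p.1 + s * p.2, - s * p.1 + c * p.2)].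
have mphi : measurable_fun [set: R * R]
    (fun p : R * R => (c * p.1 + s * p.2, - s * p.1 + c * p.2)).
  apply/measurable_fun_pairP; split;
    by apply: measurable_funD; apply: measurable_funM => //; apply: measurable_cst.
have mBB : measurable (B i `*` B j) by exact: measurableX.
have mD : measurable D by rewrite -[X in measurable X]setTI; exact: mphi.
pose A := pred2 i j.
pose C l := if A l then setT else B l.
have mC l : measurable (C l) by rewrite /C; case: ifP.
pose F : set (rvec R I) := [set x | forall l, B l (givens i j c s x l)].
have mF : measurable F.
  have -> : F = \bigcap_(l in [set: I]) (fun x : rvec R I => givens i j c s x l) @^-1` B l.
    by apply/seteqP; split=> w /= h l; [move=> _; exact: h|exact: h].
  apply: fin_bigcap_measurable; first exact: finite_finset.
  move=> l _; rewrite -[X in measurable X]setTI.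
  apply: (@measurable_givens _ (rvec R I) R I i j c s (fun l (x : rvec R I) => (x : I -> R) l) l) => //.
  exact: measurable_coord.
transitivity (P [set w | F (X ^~ w)]); first by [].
rewrite (iid_normal_law iX (iid_normal_splice A iX) mF).
have mXij : measurable [set w | D (X i w, X j w)].
  have mij : measurable_fun [set: T] (fun w => (X i w, X j w)).
    by apply/measurable_fun_pairP; split; exact: mX.
  by rewrite -[X in measurable X]setTI; exact: mij.
have mC' : measurable [set w | forall l, C l (X l w)].
  have -> : [set w | forall l, C l (X l w)] = \bigcap_(l in [set: I]) (X l @^-1` C l).
    by apply/seteqP; split=> w /= h l; [move=> _; exact: h|exact: h].
  apply: fin_bigcap_measurable; first exact: finite_finset.
  by move=> l _; rewrite -[X in measurable X]setTI; exact: mX.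
have -> : [set w | F (splice A X ^~ w)]
    = [set w | D (X i w, X j w)] `*` [set w | forall l, C l (X l w)].
  have ji : (j == i) = false by rewrite eq_sym; exact/negbTE.
  apply/seteqP; split=> w /=; rewrite /F/= /D/= /C /givens /splice/= !eqxx ?orbT.
    move=> h; split.
      by split; [have := h i; rewrite eqxx|have := h j; rewrite ji eqxx].
    by move=> l; case: ifP => // /norP[/negbTE li /negbTE lj]; have := h l; rewrite li lj.
  move=> [[h1 h2] h] l; case: eqP => [->//|/eqP li]; case: eqP => [->//|/eqP lj].
  by have := h l; rewrite (negbTE li) (negbTE lj).
transitivity (P [set w | D (X i w, X j w)] * P [set w | forall l, C l (X l w)])%E.
  exact: (product_measure1E P P mXij mC').
rewrite (iid_normal_pair ij iX mD) (normal_pair_rotation cs s0 mBB).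
have ji : j != i by rewrite eq_sym.
rewrite (proj2 iX _ mC) [RHS](bigD1 i)//= [X in _ = (_ * X)%E](bigD1 j)//=.
rewrite muleA; congr (_ * _)%E.
  by have E := product_measure1E gam gam (mB i) (mB j); exact: E.
rewrite [LHS](bigD1 i)//= {1}/C /A/= eqxx probability_setT mul1e.
rewrite [LHS](bigD1 j)//= {1}/C /A/= eqxx orbT probability_setT mul1e.
by apply: eq_bigr => l /andP[/negbTE li /negbTE lj]; rewrite /C /A/= li lj.
Qed.

End decoupling.

(** * Expectations of products over independent blocks *)

Section block_products.
Context d (T : measurableType d) (R : realType) (P : probability T R).
Notation gam := (@normal_prob R 0 1).

Lemma ge0_expectation_law d' (T' : measurableType d') (P' : probability T' R) (I : finType)
    (X : I -> T -> R) (Y : I -> T' -> R) (f : rvec R I -> \bar R) :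
  iid_normal P X -> iid_normal P' Y ->
  measurable_fun [set: rvec R I] f -> (forall x, 0 <= f x)%E ->
  (\int[P]_w f (X ^~ w) = \int[P']_w f (Y ^~ w))%E.
Proof.
move=> iX iY mf f0.
pose fX : T -> rvec R I := fun w => X ^~ w.
pose fY : T' -> rvec R I := fun w => Y ^~ w.
have mX' : measurable_fun [set: T] fX by apply: measurable_rvec; case: iX.
have mY' : measurable_fun [set: T'] fY by apply: measurable_rvec; case: iY.
pose X' : {mfun T >-> rvec R I} := HB.pack fX (isMeasurableFun.Build _ _ _ _ fX mX').
pose Y' : {mfun T' >-> rvec R I} := HB.pack fY (isMeasurableFun.Build _ _ _ _ fY mY').
rewrite -[LHS]/(\int[P]_w (f \o X') w)%E -[RHS]/(\int[P']_w (f \o Y') w)%E.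
rewrite -!ge0_integral_distribution//.
apply: eq_measure_integral => A mA _.
exact: (iid_normal_law iX iY mA).
Qed.

(** [b] labels the blocks and [f j] depends on block [j] only. Resampling splits off one block at a
    time, and Tonelli factors the integral. *)
Lemma expectation_block_prod (I : finType) (J : eqType) (b : I -> J) (X : I -> T -> R)
    (f : J -> rvec R I -> \bar R) (s : seq J) :
  iid_normal P X -> uniq s ->
  (forall j, measurable_fun [set: rvec R I] (f j)) -> (forall j x, 0 <= f j x)%E ->
  (forall j (x y : I -> R), (forall i, b i = j -> x i = y i) -> f j x = f j y) ->
  (\int[P]_w (\prod_(j <- s) f j (X ^~ w)) = \prod_(j <- s) \int[P]_w f j (X ^~ w))%E.
Proof.
move=> iX us mf f0 fb.
have mp (s' : seq J) : measurable_fun [set: rvec R I] (fun x => \prod_(j <- s') f j x)%E.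
  elim: s' => [|j s' IH].
    rewrite (_ : (fun x => _) = cst 1%E); first exact: measurable_cst.
    by apply/funext => x; rewrite big_nil.
  rewrite (_ : (fun x => _) = (fun x => f j x * \prod_(k <- s') f k x)%E).
    exact: emeasurable_funM.
  by apply/funext => x; rewrite big_cons.
have p0 (s' : seq J) x : (0 <= \prod_(j <- s') f j x)%E.
  by elim/big_rec: _ => [|j y _ y0]; [rewrite lee_fin|rewrite mule_ge0].
have mX := measurable_rvec (proj1 iX).
elim: s us => [_|j s IH /andP[js us]].
  under eq_integral do rewrite big_nil.
  by rewrite big_nil integral_cst// mul1e; exact: probability_setT.
rewrite big_cons -(IH us).
have iG := iid_normal_splice (fun i => b i == j) iX.
rewrite (ge0_expectation_law iX iG (mp (j :: s)) (p0 (j :: s))).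
pose g (z : T * T) := (f j (X ^~ z.1) * \prod_(k <- s) f k (X ^~ z.2))%E.
have gE z : (\prod_(k <- j :: s) f k (splice (fun i => b i == j) X ^~ z))%E = g z.
  rewrite big_cons /g; congr (_ * _)%E.
    by apply: fb => i bij; rewrite /splice bij eqxx.
  rewrite !big_seq; apply: eq_bigr => k ks; apply: fb => i bik.
  by rewrite /splice bik; case: eqP => // kj; move: js; rewrite -kj ks.
transitivity (\int[(P \x P)%E]_z g z)%E; first by apply: eq_integral => z _; exact: gE.
have m1 : measurable_fun [set: T * T] (fun z : T * T => f j (X ^~ z.1)).
  exact: (measurableT_comp (mf j) (measurableT_comp mX measurable_fst)).
have m2 : measurable_fun [set: T * T] (fun z : T * T => \prod_(k <- s) f k (X ^~ z.2))%E.
  exact: (measurableT_comp (mp s) (measurableT_comp mX measurable_snd)).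
have mg : measurable_fun [set: T * T] g by exact: emeasurable_funM.
have g0 z : (0 <= g z)%E by rewrite mule_ge0.
transitivity (\int[P]_x \int[P]_y g (x, y))%E.
  exact: (@fubini_tonelli1 _ _ _ _ R P P g mg g0).
have mfX : measurable_fun [set: T] (fun w => f j (X ^~ w)).
  exact: (measurableT_comp (mf j) mX).
have mpX : measurable_fun [set: T] (fun w => \prod_(k <- s) f k (X ^~ w))%E.
  exact: (measurableT_comp (mp s) mX).
have i0 : (0 <= \int[P]_y \prod_(k <- s) f k (X ^~ y))%E.
  by apply: integral_ge0 => y _; exact: p0.
rewrite -(ge0_integralZr P measurableT mfX _ i0)//.
apply: eq_integral => x _.
by rewrite -(ge0_integralZl P measurableT mpX)// => y _; exact: p0.
Qed.

End block_products.

(** * Laplace transform and lower tail of chi-square variables *)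

Section chi_square.
Context d (T : measurableType d) (R : realType) (P : probability T R).
Notation gam := (@normal_prob R 0 1).

Lemma iid_normal_integral1 (I : finType) (X : I -> T -> R) i (f : R -> \bar R) :
  iid_normal P X -> measurable_fun [set: R] f -> (forall x, 0 <= f x)%E ->
  (\int[P]_w f (X i w) = \int[gam]_x f x)%E.
Proof.
move=> iX mf f0.
pose fX : T -> measurableTypeR R := X i.
have mX : measurable_fun [set: T] fX by exact: (proj1 iX i).
pose X' : {mfun T >-> measurableTypeR R} := HB.pack fX (isMeasurableFun.Build _ _ _ _ fX mX).
rewrite -[LHS]/(\int[P]_w (f \o X') w)%E -ge0_integral_distribution//.
apply: eq_measure_integral => A mA _.
exact: (iid_normal_marginal i iX mA).
Qed.

(** Blocks of one coordinate each. Negative [a] is allowed, which later gives exponential moments of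
    a squared norm. *)
Lemma sumsq_laplace (I : finType) (X : I -> T -> R) (a : R) : -1 < a -> iid_normal P X ->
  (\int[P]_w (expR (- (a * \sum_i X i w ^+ 2) / 2))%:E
   = ((Num.sqrt (1 + a))^-1 ^+ #|I|)%:E)%E.
Proof.
move=> a1 iX.
pose e (x : R) : \bar R := (expR (- (a * x ^+ 2) / 2))%:E.
have me : measurable_fun [set: R] e.
  apply/measurable_EFinP; apply: measurableT_comp; first exact: measurable_expR.
  apply: measurable_funM; last exact: measurable_cst.
  apply: measurable_funN; apply: measurable_funM; first exact: measurable_cst.
  exact: exprn_measurable.
have e0 x : (0 <= e x)%E by rewrite lee_fin expR_ge0.
pose f (i : I) (x : rvec R I) := e ((x : I -> R) i).
have mf i : measurable_fun [set: rvec R I] (f i).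
  exact: (measurableT_comp me (measurable_coord i)).
have := expectation_block_prod (b := id) (f := f) (s := index_enum I) iX
   (index_enum_uniq I) mf (fun i x => e0 _).
rewrite /f => /(_ (fun j x y h => congr1 e (h j erefl))) E.
transitivity (\int[P]_w (\prod_(j <- index_enum I) e (X j w)))%E.
  apply: eq_integral => w _.
  have -> : - (a * \sum_i X i w ^+ 2) / 2 = \sum_i (- (a * X i w ^+ 2) / 2).
    by rewrite mulr_sumr -sumrN mulr_suml.
  by rewrite expR_sum /e prodEFin.
rewrite E.
under eq_bigr do rewrite (iid_normal_integral1 _ iX me e0) normal_laplace//.
by rewrite prodEFin prodr_const.
Qed.

(** Chernoff bound: the indicator is at most [expR (a * (z - S) / 2)], with [S] the sum of squares,
    and the parameter [a] stays free. *)
Lemma sumsq_lower_tail (I : finType) (X : I -> T -> R) (a z : R) : 0 <= a -> iid_normal P X ->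
  (P [set w | (\sum_i X i w ^+ 2 < z)%R]
   <= (expR (a * z / 2) * (Num.sqrt (1 + a))^-1 ^+ #|I|)%:E)%E.
Proof.
move=> a0 iX; have a1 : -1 < a by rewrite (lt_le_trans _ a0)// oppr_lt0.
have mS : measurable_fun [set: T] (fun w => \sum_i X i w ^+ 2).
  by apply: measurable_sum => i; apply: measurable_funX; case: iX.
pose F := [set w | \sum_i X i w ^+ 2 < z].
have mF : measurable F.
  have -> : F = [set: T] `&` (fun w => \sum_i X i w ^+ 2) @^-1` `]-oo, z[.
    by apply/seteqP; split=> x /=; rewrite in_itv/=; [|case].
  exact: mS.
pose g w : \bar R := (expR (- (a * \sum_i X i w ^+ 2) / 2))%:E.
have mg : measurable_fun [set: T] g.
  apply/measurable_EFinP; apply: measurableT_comp; first exact: measurable_expR.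
  apply: measurable_funM; last exact: measurable_cst.
  by apply: measurable_funN; apply: measurable_funM; first exact: measurable_cst.
have g0 w : (0 <= g w)%E by rewrite lee_fin expR_ge0.
have k0 : (0 <= (expR (a * z / 2))%:E :> \bar R)%E by rewrite lee_fin expR_ge0.
rewrite EFinM -(sumsq_laplace a1 iX).
rewrite -(ge0_integralZl P measurableT mg (fun w _ => g0 w) k0).
rewrite -/F -[X in P X]setIT -(integral_indic P measurableT mF).
apply: ge0_le_integral => //.
- by apply/measurable_EFinP; exact: measurable_indic.
- exact: emeasurable_funM.
- move=> w _; rewrite /g -EFinM lee_fin -expRD indicE.
  case: (boolP (w \in F)) => [|_]; last exact: expR_ge0.
  rewrite inE /F/= => wz; rewrite -[leLHS]expR0 ler_expR mulNr subr_ge0.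
  by rewrite ler_pM2r// ler_wpM2l// ltW.
Qed.

End chi_square.

(** * Isometries and distance to a span *)

Section isometries.
Variable R : realType.

(** Invariance of Gaussian families is a field, stated for all probability spaces at once, so that
    composites inherit it; [J] indexes columns that the same map transforms simultaneously. *)
Record iid_isometry (L : finType) (O : (L -> R) -> L -> R) : Prop := IidIsometry {
  iso_linear : forall c x y l, O (fun l => x l + c * y l) l = O x l + c * O y l;
  iso_norm : forall x, \sum_l O x l ^+ 2 = \sum_l x l ^+ 2;
  iso_iid : forall d (T : measurableType d) (P : probability T R) (J : finType)
    (X : L * J -> T -> R), iid_normal P X ->
    iid_normal P (fun (p : L * J) w => O (fun l => X (l, p.2) w) p.1) }.

Lemma iid_isometry_id (L : finType) : iid_isometry (fun x : L -> R => x).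
Proof.
split=> // d T P J X iX.
have -> : (fun (p : L * J) w => X (p.1, p.2) w) = X by apply/funext => -[].
by [].
Qed.

Lemma iid_isometry_comp (L : finType) (O O' : (L -> R) -> L -> R) :
  iid_isometry O -> iid_isometry O' -> iid_isometry (fun x => O (O' x)).
Proof.
move=> [l1 n1 i1] [l2 n2 i2]; split.
- move=> c x y l; rewrite -l1; congr (O _ l); apply/funext => l'; exact: l2.
- by move=> x; rewrite n1.
- move=> d T P J X iX; exact: (i1 _ _ _ _ _ (i2 _ _ _ _ _ iX)).
Qed.

Lemma iid_isometry_givens (L : finType) (i j : L) (c s : R) :
  i != j -> c ^+ 2 + s ^+ 2 = 1 -> s != 0 -> iid_isometry (givens i j c s).
Proof.
move=> ij cs s0; have ji : j != i by rewrite eq_sym.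
split.
- move=> k x y l; rewrite /givens; case: ifP => _; first by ring.
  by case: ifP => _ //; ring.
- move=> x; rewrite (bigD1 i)//= (bigD1 j)//= [RHS](bigD1 i)//= [in RHS](bigD1 j)//=.
  rewrite !addrA; congr (_ + _).
    rewrite /givens eqxx (negbTE ji) eqxx.
    transitivity ((c ^+ 2 + s ^+ 2) * (x i ^+ 2 + x j ^+ 2)); first by ring.
    by rewrite cs mul1r.
  by apply: eq_bigr => l /andP[/negbTE li /negbTE lj]; rewrite /givens li lj.
- move=> d T P J X iX.
  (* The columns are rotated one after the other: each one is a single plane rotation of the whole
     family. *)
  have step (u : seq J) : uniq u -> iid_normal P (fun (p : L * J) w =>
      if p.2 \in u then givens i j c s (fun l => X (l, p.2) w) p.1 else X p w).
    elim: u => [_|k u IH /andP[ku /IH {}IH]]; first exact: iX.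
    have kij : (i, k) != (j, k) by rewrite xpair_eqE (negbTE ij).
    have := iid_normal_givens kij cs s0 IH.
    congr (iid_normal P _); apply/funext => -[l h]; apply/funext => w.
    rewrite /givens/= in_cons !xpair_eqE (negbTE ku).
    have [->|hk] := eqVneq h k; first by rewrite /= !andbT (negbTE ku).
    by rewrite !andbF.
  have := step (enum J) (enum_uniq J); congr (iid_normal P _).
  by apply/funext => p; apply/funext => w; rewrite mem_enum.
Qed.

(** The angle is read off from [(x i, x j)]. The isometry property is given at every pair of indices
    because the same angle is reused on imaginary parts. *)
Lemma givens_kill (L : finType) (i j : L) (x : L -> R) : i != j ->
  exists c s, (forall i' j', i' != j' -> @iid_isometry L (givens i' j' c s)) /\
    givens i j c s x j = 0.
Proof.
move=> ij; have ji : (j == i) = false by rewrite eq_sym; exact/negbTE.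
have [xj|xj] := eqVneq (x j) 0.
  (* [iid_isometry_givens] excludes [s = 0]; here the rotation is the identity. *)
  exists 1, 0; split; last by rewrite /givens ji eqxx xj oppr0 mul0r mulr0 addr0.
  move=> i' j' _.
  have -> : givens i' j' 1 0 = (fun y : L -> R => y); last exact: iid_isometry_id.
  rewrite funeqE => y; rewrite funeqE => l; rewrite /givens.
  case: eqP => [->|_]; first by rewrite mul1r mul0r addr0.
  by case: eqP => // ->; rewrite oppr0 mul0r mul1r add0r.
pose r := Num.sqrt (x i ^+ 2 + x j ^+ 2).
have r0 : 0 < x i ^+ 2 + x j ^+ 2 by rewrite ltr_wpDl ?sqr_ge0// exprn_even_gt0.
have r2 : r ^+ 2 = x i ^+ 2 + x j ^+ 2 by rewrite sqr_sqrtr// ltW.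
have rn : r != 0 by rewrite gt_eqF// sqrtr_gt0.
have cs : (x i / r) ^+ 2 + (x j / r) ^+ 2 = 1.
  by rewrite !expr_div_n -mulrDl -r2 divff// expf_neq0.
exists (x i / r), (x j / r); split => //.
  by move=> i' j' ij'; apply: iid_isometry_givens => //; rewrite mulf_neq0// invr_eq0.
by rewrite /givens ji eqxx; field.
Qed.

End isometries.

Section near_span.
Variable R : realType.

(** Plane rotations against the axis [i0] kill the other coordinates one by one; a later one leaves
    the earlier zeros alone. *)
Lemma isometry_to_axis (L : finType) (x : L -> R) (i0 : L) :
  exists O, iid_isometry O /\ forall i, i != i0 -> O x i = 0.
Proof.
suff H (s : seq L) : i0 \notin s -> exists O : (L -> R) -> L -> R,
    iid_isometry O /\ forall i, i \in s -> O x i = 0.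
  have [|O [iO O0]] := H [seq i <- enum L | i != i0].
    by rewrite mem_filter eqxx.
  by exists O; split=> // i ii0; apply: O0; rewrite mem_filter ii0 mem_enum.
elim: s => [_|i s IH]; first by exists (fun y => y); split=> //; exact: iid_isometry_id.
rewrite in_cons negb_or => /andP[i0i is0]; have [ O [iO O0]] := IH is0.
have [c [t [iG Gi]]] := givens_kill (O x) i0i.
exists (fun y => givens i0 i c t (O y)); split.
  by apply: iid_isometry_comp => //; exact: iG.
move=> l; rewrite in_cons; have [->//|li /= ls] := eqVneq l i.
have li0 : l != i0 by apply: contraNneq is0 => <-.
by rewrite /givens (negbTE li0) (negbTE li) O0.
Qed.

(* The squared distance from [x] to the span of [vs] is below [z]. *)
Fixpoint near_span (I : finType) (vs : seq (I -> R)) (x : I -> R) (z : R) : Prop :=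
  if vs is v :: vs' then exists c : R, near_span vs' (fun i => x i + c * v i) z
  else \sum_i x i ^+ 2 < z.

Lemma near_span_lincomb (I : finType) (J : Type) (s : seq J) (V : J -> I -> R) (c : J -> R)
    (x : I -> R) (z : R) :
  \sum_i (x i + \sum_(j <- s) c j * V j i) ^+ 2 < z ->
  near_span [seq V j | j <- s] x z.
Proof.
elim: s x => [|j s IH] x /=; first by under eq_bigr do rewrite big_nil addr0.
move=> H; exists (c j); apply: IH; congr (_ < _): H; apply: eq_bigr => i _.
by rewrite big_cons addrA.
Qed.

Lemma near_span_isometry (I : finType) (O : (I -> R) -> I -> R) vs x z :
  iid_isometry O -> near_span vs x z -> near_span [seq O v | v <- vs] (O x) z.
Proof.
move=> [Ol On _]; elim: vs x => [|v vs IH] x /=; first by rewrite On.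
move=> [c /IH H]; exists c; congr (near_span _ _ _): H.
by apply/funext => i; exact: Ol.
Qed.

(** Forgetting coordinates can only decrease a sum of squares. *)
Lemma near_span_restrict (I J : finType) (h : J -> I) vs x z :
  injective h -> near_span vs x z -> near_span [seq v \o h | v <- vs] (x \o h) z.
Proof.
move=> hi; elim: vs x => [|v vs IH] x /=.
  apply: le_lt_trans.
  rewrite (bigID (mem (codom h)))/= -[leLHS]addr0 lerD//; last first.
    by apply: sumr_ge0 => i _; exact: sqr_ge0.
  rewrite -[leRHS]big_uniq/=; last by rewrite map_inj_uniq ?enum_uniq.
  by rewrite /image_mem big_map big_enum.
by move=> [c /IH H]; exists c.
Qed.

(* Rotating one vector of [vs] to an axis and dropping that coordinate removes it from the
   span. The covering event [F] spares the measurability of [near_span]. *)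
Lemma near_span_tail (a z : R) (vs_size : nat) d (T : measurableType d) (P : probability T R)
    (I : finType) (X : I -> T -> R) (vs : seq (I -> R)) :
  0 <= a -> size vs = vs_size -> (vs_size <= #|I|)%N -> iid_normal P X ->
  exists F, [/\ measurable F, forall w, near_span vs (X ^~ w) z -> F w &
    (P F <= (expR (a * z / 2) * (Num.sqrt (1 + a))^-1 ^+ (#|I| - vs_size))%:E)%E].
Proof.
move=> a0; elim: vs_size I X vs => [|q IH] I X [|v vs]//= sv qI iX.
  exists [set w | \sum_i X i w ^+ 2 < z]; split => //.
  - have mS : measurable_fun [set: T] (fun w => \sum_i X i w ^+ 2).
      by apply: measurable_sum => i; apply: measurable_funX; case: iX.
    rewrite (_ : [set w | _] = [set: T] `&` (fun w => \sum_i X i w ^+ 2) @^-1` `]-oo, z[).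
      exact: mS.
    by apply/seteqP; split=> w /=; rewrite in_itv/=; [|case].
  - by rewrite subn0; exact: sumsq_lower_tail.
have [i0 _] : exists i0 : I, true.
  by have /card_gt0P[i0 _] : (0 < #|I|)%N by exact: leq_ltn_trans qI.
have [ O [iO O0]] := isometry_to_axis v i0.
pose J := {i : I | i != i0}.
have cJ : #|{: J}| = #|I|.-1 by rewrite card_sig -(cardC1 i0); apply: eq_card.
(* The rotated coordinates off [i0] are again independent Gaussians. One coordinate and one spanning
   vector are lost together, so the exponent is unchanged. *)
pose X' (j : J) w := O (X ^~ w) (val j).
have iX' : iid_normal P X'.
  have h1 : injective (fun p : I * unit => p.1) by case=> i [] [j []] /= ->.
  have h2 : injective (fun j : J => (val j, tt)) by move=> j k [] /val_inj.
  exact: (iid_normal_sub h2 (iso_iid iO (iid_normal_sub h1 iX))).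
have cI : (0 < #|I|)%N by exact: leq_ltn_trans qI.
have [||//|F [mF FX PF]] := IH J X' [seq O u \o val | u <- vs].
- by rewrite size_map; case: sv.
- by rewrite cJ -ltnS prednK.
exists F; split => //; last by move: PF; rewrite cJ -subn1 subnAC subn1 subnS.
move=> w [c H]; apply: FX.
have /(near_span_restrict (h := val : J -> I) val_inj) := near_span_isometry iO H.
rewrite -map_comp; congr (near_span _ _ _); apply/funext => j.
by rewrite /= (iso_linear iO) (O0 _ (valP j)) mulr0 addr0.
Qed.

End near_span.

(** * Unitary maps of complex space in real coordinates *)

Section complex_isometries.
Variables (R : realType) (K : finType).
Implicit Types (u a x : K * bool -> R).

(* [K * bool -> R] encodes C^K; [imul] is multiplication by the imaginary unit. *)
Definition imul u (l : K * bool) : R := if l.2 then u (l.1, false) else - u (l.1, true).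

(* |a^* u|^2 *)
Definition cabs2 a u : R :=
  (\sum_l a l * u l) ^+ 2 + (\sum_l a l * imul u l) ^+ 2.

(** A real linear isometry that commutes with the imaginary unit is unitary. *)
Definition cx_isometry (O : (K * bool -> R) -> K * bool -> R) : Prop :=
  iid_isometry O /\ forall u, O (imul u) = imul (O u).

Lemma cx_isometry_comp O O' :
  cx_isometry O -> cx_isometry O' -> cx_isometry (fun x => O (O' x)).
Proof.
move=> [i1 c1] [i2 c2]; split; first exact: iid_isometry_comp.
by move=> u; rewrite c2 c1.
Qed.

Lemma iid_isometry_dot (L : finType) (O : (L -> R) -> L -> R) (a u : L -> R) :
  iid_isometry O -> \sum_l O a l * O u l = \sum_l a l * u l.
Proof.
move=> iO.
have E (v w : L -> R) : \sum_l (v l + 1 * w l) ^+ 2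
    = \sum_l v l ^+ 2 + \sum_l w l ^+ 2 + 2 * \sum_l v l * w l.
  rewrite mulr_sumr -!big_split/=; apply: eq_bigr => l _; ring.
have := iso_norm iO (fun l => a l + 1 * u l); rewrite E.
under eq_bigr do rewrite (iso_linear iO).
rewrite E !(iso_norm iO) => /addrI/mulfI -> //.
Qed.

Lemma cabs2_isometry O a u : cx_isometry O -> cabs2 (O a) (O u) = cabs2 a u.
Proof. by move=> [iO cO]; rewrite /cabs2 -cO !(iid_isometry_dot _ _ iO). Qed.

(** Rotating the real and imaginary parts of one entry multiplies that entry by a phase, so it
    commutes with [imul]. *)
Lemma phase_kill x (k : K) : exists O, [/\ cx_isometry O, O x (k, true) = 0 &
  forall l, l.1 != k -> O x l = x l].
Proof.
have kk : (k, false) != (k, true) by rewrite xpair_eqE andbF.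
have [c [s [iG Gk]]] := givens_kill x kk.
exists (givens (k, false) (k, true) c s); split => //.
- split; first exact: iG.
  move=> u; apply/funext => -[l b]; rewrite /imul /givens/= !xpair_eqE !eqxx !andbT/=.
  by case: b; case: (l == k); rewrite /= ?andbF //=; ring.
- by move=> [l b] /= /negbTE lk; rewrite /givens !xpair_eqE lk.
Qed.

(** The same real angle on real and imaginary parts: a complex plane rotation with real
    coefficients. *)
Definition givens2 (k0 k : K) (c s : R) x (l : K * bool) : R :=
  if l.1 == k0 then c * x (k0, l.2) + s * x (k, l.2)
  else if l.1 == k then - s * x (k0, l.2) + c * x (k, l.2) else x l.

Lemma givens2E (k0 k : K) (c s : R) : k0 != k ->
  givens2 k0 k c s = fun x => givens (k0, true) (k, true) c s (givens (k0, false) (k, false) c s x).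
Proof.
move=> kk; have kk' : (k == k0) = false by rewrite eq_sym; exact/negbTE.
rewrite funeqE => x; rewrite funeqE => -[l b].
rewrite /givens2 /givens/= !xpair_eqE /= !andbF.
by case: b; rewrite ?andbT ?andbF ?kk'//=; do ?[case: eqP => //=].
Qed.

Lemma unitary_to_axis x (k0 : K) :
  exists O, cx_isometry O /\ forall k b, k != k0 -> O x (k, b) = 0.
Proof.
(* Keeping the entry [k0] real is part of the induction: once the entry [k] is made real too, one
   real angle kills it. *)
suff H (s : seq K) : k0 \notin s -> exists O, [/\ cx_isometry O, O x (k0, true) = 0 &
    forall k b, k \in s -> O x (k, b) = 0].
  have [|O [iO _ O0]] := H [seq i <- enum K | i != k0].
    by rewrite mem_filter eqxx.
  by exists O; split=> // i b ii0; apply: O0; rewrite mem_filter ii0 mem_enum.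
elim: s => [_|k s IH].
  by have [ O [iO Ok _]] := phase_kill x k0; exists O; split.
rewrite in_cons negb_or => /andP[k0k ks]; have [ O [iO Ok O0]] := IH ks.
have [ O' [iO' O'k O'E]] := phase_kill (O x) k.
have kk0 : (k == k0) = false by rewrite eq_sym; exact/negbTE.
pose y := O' (O x).
have y0 : y (k0, true) = 0 by rewrite /y O'E.
have yk : y (k, true) = 0 by [].
have ff : (k0, false) != (k, false) by rewrite xpair_eqE (negbTE k0k).
have tt' : (k0, true) != (k, true) by rewrite xpair_eqE (negbTE k0k).
have [c [t [iG Gk]]] := givens_kill y ff.
have iG2 : cx_isometry (givens2 k0 k c t).
  split; first by rewrite givens2E//; apply: iid_isometry_comp; exact: iG.
  move=> u; apply/funext => -[l b]; rewrite /imul /givens2/=.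
  by case: b; case: (l == k0) => //=; case: (l == k) => //=; ring.
exists (fun x => givens2 k0 k c t (O' (O x))); split.
- by apply: cx_isometry_comp => //; exact: cx_isometry_comp.
- by rewrite -/y /givens2/= eqxx y0 yk !mulr0 addr0.
- move=> l b; rewrite in_cons -/y /givens2/=.
  have [->|lk] := eqVneq l k.
    rewrite kk0 => _; case: b; first by rewrite y0 yk !mulr0 addr0.
    by move: Gk; rewrite /givens !xpair_eqE kk0 !eqxx /=.
  move=> /= ls.
  have /negbTE -> : l != k0 by apply: contraTneq ls => ->; exact: ks.
  by rewrite /y O'E// O0.
Qed.

End complex_isometries.

(** * The least eigenvalue of a Gaussian Gram matrix *)

Section rational_approximation.
Variables (R : realType) (L : finType).

(** Sequential continuity for coordinatewise convergence, enough to move a strict inequality to a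
    rational vector. *)
Definition seq_cont (f : (L -> R) -> R) : Prop :=
  forall (u_ : nat -> L -> R) (u : L -> R),
    (forall l, u_ n l @[n --> \oo] --> u l) -> f (u_ n) @[n --> \oo] --> f u.

Lemma seq_cont_cst c : seq_cont (fun=> c).
Proof. by move=> u_ u _; exact: cvg_cst. Qed.

Lemma seq_cont_coord l : seq_cont (fun u => u l).
Proof. by move=> u_ u; exact. Qed.

Lemma seq_contD f g : seq_cont f -> seq_cont g -> seq_cont (fun u => f u + g u).
Proof. by move=> cf cg u_ u uu; apply: cvgD; [exact: cf|exact: cg]. Qed.

Lemma seq_contM f g : seq_cont f -> seq_cont g -> seq_cont (fun u => f u * g u).
Proof. by move=> cf cg u_ u uu; apply: cvgM; [exact: cf|exact: cg]. Qed.

Lemma seq_contN f : seq_cont f -> seq_cont (fun u => - f u).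
Proof. by move=> cf u_ u uu; apply: (@cvgN _ R^o); exact: cf. Qed.

Lemma seq_contX2 f : seq_cont f -> seq_cont (fun u => f u ^+ 2).
Proof. by move=> cf; exact: seq_contM. Qed.

Lemma seq_cont_sum (J : Type) (s : seq J) (f : J -> (L -> R) -> R) :
  (forall j, seq_cont (f j)) -> seq_cont (fun u => \sum_(j <- s) f j u).
Proof.
move=> cf; elim: s => [|j s IH].
  rewrite (_ : (fun u => _) = fun=> 0); first exact: seq_cont_cst.
  by apply/funext => u; rewrite big_nil.
rewrite (_ : (fun u => _) = fun u => f j u + \sum_(k <- s) f k u).
  exact: seq_contD.
by apply/funext => u; rewrite big_cons.
Qed.

Definition of_rat (q : {ffun L -> rat}) (l : L) : R := ratr (q l).

Lemma seq_cont_rat (f : (L -> R) -> R) (u : L -> R) : seq_cont f -> f u < 0 ->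
  exists q, f (of_rat q) < 0.
Proof.
move=> cf fu.
have H (n : nat) (l : L) : {q : rat | u l < ratr q < u l + n.+1%:R^-1}.
  apply: cid; have [q qI] : exists q, ratr q \in `]u l, (u l + n.+1%:R^-1)[.
    by apply: rat_in_itvoo; rewrite ltrDl invr_gt0.
  by exists q; move: qI; rewrite in_itv.
pose q_ n : {ffun L -> rat} := [ffun l => sval (H n l)].
have cq l : of_rat (q_ n) l @[n --> \oo] --> u l.
  apply: (@squeeze_cvgr _ _ _ _ (fun=> u l) (fun n => u l + n.+1%:R^-1)).
  - by apply: nearW => n; rewrite /of_rat ffunE; case: (H n l) => /= q /andP[/ltW -> /ltW ->].
  - exact: cvg_cst.
  - rewrite -[X in _ --> X]addr0; apply: cvgD; first exact: cvg_cst.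
    exact: cvg_harmonic.
have /cvgr_lt/(_ _ fu) [N _ HN] := cf _ _ cq.
by exists (q_ N); exact: (HN N (leqnn N)).
Qed.

End rational_approximation.

Section least_eigenvalue.
Variables (R : realType) (K : finType).
Notation L := (K * bool)%type.

Lemma seq_cont_imul l : seq_cont (fun u : L -> R => imul u l).
Proof.
rewrite /imul; case: l => k [] /=; first exact: seq_cont_coord.
by apply: seq_contN; exact: seq_cont_coord.
Qed.

Lemma seq_cont_cabs2 (a : L -> R) : seq_cont (cabs2 a).
Proof.
apply: seq_contD; apply: seq_contX2; apply: seq_cont_sum => l; apply: seq_contM.
- exact: seq_cont_cst.
- exact: seq_cont_coord.
- exact: seq_cont_cst.
- exact: seq_cont_imul.
Qed.

Lemma measurable_cabs2 d (T : measurableType d) (a : L -> T -> R) u :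
  (forall l, measurable_fun [set: T] (a l)) ->
  measurable_fun [set: T] (fun w => cabs2 (a ^~ w) u).
Proof.
move=> ma; apply: measurable_funD; apply: measurable_funX; apply: measurable_sum => l;
  by apply: measurable_funM => //; exact: measurable_cst.
Qed.

Lemma cabs2_ge0 (a u : L -> R) : 0 <= cabs2 a u.
Proof. by rewrite addr_ge0 ?sqr_ge0. Qed.

(* The least eigenvalue of [\sum_j G_j G_j^H] is below [y]; only rational test vectors
   are used, so that the event is a countable union. *)
Definition small_eig (J : finType) (y : R) (G : J -> L -> R) : Prop :=
  exists q, \sum_j cabs2 (G j) (of_rat R q) < y * \sum_l of_rat R q l ^+ 2.

(* With [W = \sum_j G_j G_j^H], this says [h^H W^-1 h > s]. *)
Definition leverage (J : finType) (s : R) (h : L -> R) (G : J -> L -> R) : Prop :=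
  exists q, s * \sum_j cabs2 (G j) (of_rat R q) < cabs2 h (of_rat R q).

Lemma countable_union_lt d (T : measurableType d) (f g : {ffun L -> rat} -> T -> R) :
  (forall q, measurable_fun [set: T] (f q)) -> (forall q, measurable_fun [set: T] (g q)) ->
  measurable [set w | exists q, f q w < g q w].
Proof.
move=> mf mg.
rewrite (_ : [set w | _] = \bigcup_q [set w | f q w < g q w]); last first.
  by apply/seteqP; split=> w /= => [[q H]|[q _ H]]; exists q.
apply: countable_bigcupT_measurable; first exact: countableP.
move=> q; have := measurable_fun_ltr (mf q) (mg q).
move=> /(_ measurableT [set true] I); rewrite setTI; congr (measurable _).
Qed.

Lemma measurable_small_eig d (T : measurableType d) (J : finType) y (G : J -> L -> T -> R) :
  (forall j l, measurable_fun [set: T] (G j l)) ->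
  measurable [set w | small_eig y (fun j l => G j l w)].
Proof.
move=> mG; apply: countable_union_lt => q; last exact: measurable_cst.
by apply: measurable_sum => j; apply: measurable_cabs2.
Qed.

Lemma measurable_leverage d (T : measurableType d) (J : finType) s (h : L -> T -> R)
    (G : J -> L -> T -> R) :
  (forall l, measurable_fun [set: T] (h l)) -> (forall j l, measurable_fun [set: T] (G j l)) ->
  measurable [set w | leverage s (h ^~ w) (fun j l => G j l w)].
Proof.
move=> mh mG; apply: countable_union_lt => q; last exact: measurable_cabs2.
apply: measurable_funM; first exact: measurable_cst.
by apply: measurable_sum => j; apply: measurable_cabs2.
Qed.

Lemma iid_normal_isometry d (T : measurableType d) (P : probability T R) (I : finType)
    (O : (I -> R) -> I -> R) (X : I -> T -> R) :
  iid_isometry O -> iid_normal P X -> iid_normal P (fun i w => O (X ^~ w) i).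
Proof.
move=> iO iX.
have h1 : injective (fun p : I * unit => p.1) by case=> i [] [j []] /= ->.
have h2 : injective (fun i : I => (i, tt)) by move=> j k [].
exact: (iid_normal_sub h2 (iso_iid iO (iid_normal_sub h1 iX))).
Qed.

Lemma cabs2_axis (k0 : K) (a u : L -> R) : (forall k b, k != k0 -> u (k, b) = 0) ->
  cabs2 a u = (a (k0, false) ^+ 2 + a (k0, true) ^+ 2) * \sum_l u l ^+ 2.
Proof.
move=> u0.
have red (f : L -> R) : (forall k b, k != k0 -> f (k, b) = 0) ->
    \sum_l f l = f (k0, false) + f (k0, true).
  move=> f0; have ft : (k0, false) != (k0, true) by rewrite xpair_eqE andbF.
  rewrite (bigD1 (k0, false))//= (bigD1 (k0, true)) 1?eq_sym//=.
  rewrite big1 ?addr0// => -[k b] /andP[]; rewrite !xpair_eqE.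
  by have [->|kk _ _] := eqVneq k k0; [case: b|exact: f0].
rewrite /cabs2 !red; first by rewrite /imul/=; ring.
- by move=> k b kk; rewrite u0// expr0n.
- by move=> k b kk; rewrite /imul; case: b; rewrite /= u0// ?oppr0 mulr0.
- by move=> k b kk; rewrite u0// mulr0.
Qed.

(** After a unitary change of frame taking [u] to the axis [k0], only the two real coordinates of
    one Gaussian entry matter. *)
Lemma cabs2_upper_tail d (T : measurableType d) (P : probability T R) (k0 : K)
    (X : L -> T -> R) u z :
  iid_normal P X -> 0 <= z -> 0 < \sum_l u l ^+ 2 ->
  P [set w | 2 * z * \sum_l u l ^+ 2 <= cabs2 (X ^~ w) u] = (expR (- z))%:E.
Proof.
move=> iX z0 upos.
have [ O [cO O0]] := unitary_to_axis u k0.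
have iY := iid_normal_isometry (proj1 cO) iX.
have ft : (k0, true) != (k0, false) by rewrite xpair_eqE andbF.
pose D := [set p : R * R | 2 * z <= p.1 ^+ 2 + p.2 ^+ 2].
have mD : measurable D.
  have -> : D = [set: R * R] `&` (fun p : R * R => p.1 ^+ 2 + p.2 ^+ 2) @^-1` `[2 * z, +oo[.
    by apply/seteqP; split=> x /=; rewrite in_itv/= andbT; [|case].
  have mf : measurable_fun [set: R * R] (fun p : R * R => p.1 ^+ 2 + p.2 ^+ 2).
    by apply: measurable_funD; apply: measurable_funX.
  exact: mf.
rewrite -(normal_pair_radial z0) -/D -(iid_normal_pair ft iY mD).
congr (P _); apply/seteqP; split=> w;
  rewrite /D/= -(cabs2_isometry (X ^~ w) u cO) (cabs2_axis _ O0) (iso_norm (proj1 cO));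
  by rewrite ler_pM2r// addrC.
Qed.

End least_eigenvalue.

(** * Conditioning on part of the coordinates *)

Section conditioning.
Context d (T : measurableType d) (R : realType) (P : probability T R).
Variables (I : finType) (A : pred I) (X : I -> T -> R) (F : set (rvec R I)).
Hypotheses (iX : iid_normal P X) (mF : measurable F).

(** [w1] fixes the coordinates in [A], while [w2] supplies the others. *)
Let sec w1 w2 := F (fun i => if A i then X i w1 else X i w2).

Lemma measurable_section w1 : measurable [set w2 | sec w1 w2].
Proof.
rewrite -[X in measurable X]setTI.
apply: (@measurable_rvec R I _ T (fun i w2 => if A i then X i w1 else X i w2)) => // i.
by case: (A i); [exact: measurable_cst|exact: (proj1 iX)].
Qed.

Lemma measurable_section_prob : measurable_fun [set: T] (fun w1 => P [set w2 | sec w1 w2]).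
Proof.
pose B := [set z : T * T | F (splice A X ^~ z)].
have mB : measurable B.
  rewrite -[X in measurable X]setTI.
  by apply: measurable_rvec => // i; apply: measurable_splice; case: iX.
have := measurable_fun_xsection P mB; congr (measurable_fun _ _).
apply/funext => w1 /=; congr (P _).
by apply/seteqP; split=> w2; rewrite /xsection/= inE.
Qed.

Lemma conditional_le (c : T -> \bar R) :
  measurable_fun [set: T] c -> (forall w1, P [set w2 | sec w1 w2] <= c w1)%E ->
  (P [set w | F (X ^~ w)] <= \int[P]_w c w)%E.
Proof.
move=> mc cle; rewrite (iid_normal_decouple A iX mF).
by apply: ge0_le_integral => //; [exact: measurable_section_prob|move=> w1 _; exact: cle].
Qed.

Lemma conditional_ge (c : T -> \bar R) :
  measurable_fun [set: T] c -> (forall w1, 0 <= c w1)%E ->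
  (forall w1, c w1 <= P [set w2 | sec w1 w2])%E ->
  (\int[P]_w c w <= P [set w | F (X ^~ w)])%E.
Proof.
move=> mc c0 cle; rewrite (iid_normal_decouple A iX mF).
apply: ge0_le_integral => //; exact: measurable_section_prob.
Qed.

Lemma conditional_le_cst (c : \bar R) :
  (forall w1, P [set w2 | sec w1 w2] <= c)%E ->
  (P [set w | F (X ^~ w)] <= c)%E.
Proof.
move=> cle; apply: le_trans (conditional_le _ cle) _; first exact: measurable_cst.
rewrite integral_cst// [X in (c * X)%E](_ : _ = 1%E) ?mule1//.
exact: probability_setT.
Qed.

End conditioning.

(** * Lower tail of the least eigenvalue *)

Section least_eigenvalue_tail.
Context d (T : measurableType d) (R : realType) (P : probability T R).
Variable K : finType.
Notation L := (K * bool)%type.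
Implicit Types J : finType.

(* The real coordinates of the row [k] of [G], multiplied by [-i] when [b]. *)
Let row_vec J (G : L * J -> R) (k : K) (b : bool) (p : J * bool) : R :=
  if b then (if p.2 then - G ((k, false), p.1) else G ((k, true), p.1))
  else G ((k, p.2), p.1).

Lemma sum_pair_bool (K' : finType) (f : K' * bool -> R) :
  \sum_l f l = \sum_k (f (k, false) + f (k, true)).
Proof.
rewrite (eq_bigr (fun l : K' * bool => f (l.1, l.2))); last by case.
rewrite -(pair_bigA _ (fun k b => f (k, b)))/=.
by apply: eq_bigr => k _; rewrite big_bool addrC.
Qed.

Lemma sum_off_pair (k0 : K) (f : L -> R) :
  \sum_(l | l.1 != k0) f l = \sum_(k | k != k0) (f (k, false) + f (k, true)).
Proof.
rewrite big_mkcond sum_pair_bool [RHS]big_mkcond/=; apply: eq_bigr => k _.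
by case: ifP => // _; rewrite addr0.
Qed.

Lemma sum_off (k0 : K) (f : L -> R) :
  \sum_l f l = f (k0, false) + f (k0, true) + \sum_(l | l.1 != k0) f l.
Proof. by rewrite sum_off_pair sum_pair_bool (bigD1 k0). Qed.

Lemma dot_imul (a u : L -> R) :
  \sum_l a l * imul u l = \sum_k (a (k, true) * u (k, false) - a (k, false) * u (k, true)).
Proof.
rewrite sum_pair_bool; apply: eq_bigr => k _.
by rewrite /imul/= mulrN addrC.
Qed.

Lemma cabs2C (a u : L -> R) : cabs2 a u = cabs2 u a.
Proof.
rewrite /cabs2; congr (_ + _); first by congr (_ ^+ 2); apply: eq_bigr => l _; rewrite mulrC.
rewrite -[RHS]sqrrN; congr (_ ^+ 2); rewrite !dot_imul -sumrN; apply: eq_bigr => k _; ring.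
Qed.

(** Dividing the test vector [w] by its entry [k0] makes that entry 1; the form at the quotient is
    then the squared norm of row [k0] plus a real combination of the other rows and their multiples
    by [-i]. *)
Lemma small_distance_near_span J (G : L * J -> R) (k0 : K) (w : L -> R) (s H : R) :
  0 < s ->
  s * \sum_j cabs2 (fun l => G (l, j)) w < H * (w (k0, false) ^+ 2 + w (k0, true) ^+ 2) ->
  near_span [seq row_vec G l.1 l.2 | l <- enum {: L} & l.1 != k0] (fun p => G ((k0, p.2), p.1)) (H / s).
Proof.
move=> s0 hyp.
set om := w (k0, false) ^+ 2 + w (k0, true) ^+ 2 in hyp.
have lhs0 : 0 <= s * \sum_j cabs2 (fun l => G (l, j)) w.
  by rewrite mulr_ge0 ?(ltW s0)// sumr_ge0// => j _; exact: cabs2_ge0.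
have om0 : 0 < om.
  rewrite lt_neqAle eq_sym addr_ge0 ?sqr_ge0// andbT; apply/eqP => om0.
  by move: hyp; rewrite om0 mulr0 ltNge lhs0.
have omn : om != 0 by rewrite gt_eqF.
(* [v] is [w / w_k0], that is, [w] times the conjugate of [w_k0] over its squared modulus [om]. *)
pose v l := (w (k0, false) * w l - w (k0, true) * imul w l) / om.
have v1 : v (k0, false) = 1.
  rewrite /v /imul/= mulrN opprK -!expr2; exact: divff.
have v2 : v (k0, true) = 0 by rewrite /v /imul/= [X in X - _]mulrC subrr mul0r.
have vE a : cabs2 a w = om * cabs2 a v.
  have -> : cabs2 a v = (((w (k0, false) * \sum_l a l * w l
        - w (k0, true) * \sum_l a l * imul w l) / om) ^+ 2
      + ((w (k0, false) * \sum_l a l * imul w l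
        + w (k0, true) * \sum_l a l * w l) / om) ^+ 2).
    rewrite /cabs2; congr (_ ^+ 2 + _ ^+ 2).
      rewrite !mulr_sumr -sumrB mulr_suml; apply: eq_bigr => l _; rewrite /v; ring.
    rewrite !mulr_sumr -big_split mulr_suml/=; apply: eq_bigr => -[l b] _.
    by rewrite /v /imul/=; case: b => /=; ring.
  by rewrite /cabs2 /om; field; exact: omn.
apply: (near_span_lincomb (c := v)).
have E : s * \sum_j cabs2 (fun l => G (l, j)) v < H.
  rewrite -(ltr_pM2r om0); apply: le_lt_trans hyp.
  rewrite -mulrA mulr_suml ler_pM2l//; apply: ler_sum => j _.
  by rewrite vE mulrC.
rewrite ltr_pdivlMr// mulrC; apply: le_lt_trans E.
rewrite ler_pM2l// sum_pair_bool; apply: ler_sum => j _.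
rewrite /cabs2 /=; apply: lerD; rewrite big_filter big_enum_cond/=.
  rewrite (sum_off k0) v1 v2 mulr1 mulr0 addr0.
  rewrite le_eqVlt; apply/orP; left; apply/eqP; congr ((_ + _) ^+ 2).
  by apply: eq_bigr => -[k b] _; rewrite /row_vec/= mulrC; case: b.
rewrite dot_imul (bigD1 k0)//= v1 v2 mulr0 subr0 mulr1.
rewrite le_eqVlt; apply/orP; left; apply/eqP; congr ((_ + _) ^+ 2).
rewrite sum_off_pair; apply: eq_bigr => k _; rewrite /row_vec/=; ring.
Qed.

(** A unitary map takes [h] to the axis [k0], so the event says that row [k0] is near the span of
    the other rows. With these rows fixed, [near_span_tail] at [a = s * th] and squared distance
    [|h|^2 / s] gives the bound. *)
Lemma leverage_tail J (Y : L * J -> T -> R) (k0 : K) (h : L -> R) (s th : R) :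
  iid_normal P Y -> 0 < s -> 0 <= th -> (#|K| <= #|J|.+1)%N ->
  (P [set w | leverage s h (fun j l => Y (l, j) w)]
   <= (expR (th * (\sum_l h l ^+ 2) / 2)
       * (Num.sqrt (1 + s * th))^-1 ^+ (2 * (#|J|.+1 - #|K|)))%:E)%E.
Proof.
move=> iY s0 th0 KJ.
pose H := \sum_l h l ^+ 2.
have [ O [cO O0]] := unitary_to_axis h k0.
have iG := iso_iid (proj1 cO) iY.
set G := (fun (p : L * J) w => _) in iG.
pose gap (q : {ffun L -> rat}) (x : L * J -> R) :=
  s * \sum_j cabs2 (fun l => x (l, j)) (of_rat R q).
pose lead (q : {ffun L -> rat}) : R :=
  H * (of_rat R q (k0, false) ^+ 2 + of_rat R q (k0, true) ^+ 2).
pose F : set (rvec R (L * J)%type) := [set x | exists q, gap q x < lead q].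
have mF : measurable F.
  apply: countable_union_lt => q; last exact: measurable_cst.
  apply: measurable_funM; first exact: measurable_cst.
  apply: measurable_sum => j.
  apply: (@measurable_cabs2 R K _ (rvec R (L * J)%type) (fun l x => (x : L * J -> R) (l, j))) => l.
  exact: measurable_coord.
have sub : [set w | leverage s h (fun j l => Y (l, j) w)] `<=` [set w | F (G ^~ w)].
  move=> w [q hq].
  (* The rotated test vector need not be rational; strictness and continuity supply a rational one
     nearby. *)
  pose f (u : L -> R) := s * (\sum_j cabs2 (fun l => G (l, j) w) u)
    + - (H * (u (k0, false) ^+ 2 + u (k0, true) ^+ 2)).
  have cf : seq_cont f.
    apply: seq_contD.
      apply: seq_contM; first exact: seq_cont_cst.
      by apply: seq_cont_sum => j; exact: seq_cont_cabs2.
    apply: seq_contN; apply: seq_contM; first exact: seq_cont_cst.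
    by apply: seq_contD; apply: seq_contX2; exact: seq_cont_coord.
  have fO : f (O (of_rat R q)) < 0.
    rewrite /f subr_lt0.
    have -> : \sum_j cabs2 (fun l => G (l, j) w) (O (of_rat R q))
        = \sum_j cabs2 (fun l => Y (l, j) w) (of_rat R q).
      by apply: eq_bigr => j _; rewrite -[RHS](cabs2_isometry _ _ cO).
    apply: lt_le_trans hq _; rewrite -(cabs2_isometry _ _ cO).
    by rewrite /H -(iso_norm (proj1 cO) h) cabs2C (cabs2_axis _ O0) mulrC.
  have [q' hq'] := seq_cont_rat cf fO.
  by exists q'; rewrite /gap /lead -subr_lt0.
have mlev : measurable [set w | leverage s h (fun j l => Y (l, j) w)].
  apply: (@measurable_leverage R K _ T J s (fun l _ => h l) (fun j l => Y (l, j))).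
    by move=> l; exact: measurable_cst.
  by move=> j l; case: iY.
apply: (@le_trans _ _ (P [set w | F (G ^~ w)])).
  apply: le_measure => //; rewrite inE//.
  by rewrite -[X in measurable X]setTI; apply: measurable_rvec => //; case: iG.
apply: (conditional_le_cst (A := fun p : L * J => p.1.1 != k0) iG mF) => w1.
have hinj : injective (fun p : J * bool => ((k0, p.2), p.1)) by move=> [j b] [j' b'] [-> ->].
have iR := iid_normal_sub hinj iG.
pose x1 p := G p w1.
pose vs := [seq row_vec x1 l.1 l.2 | l <- enum {: L} & l.1 != k0].
have svs : size vs = (2 * #|K|.-1)%N.
  rewrite /vs size_map -(size_map id) map_id size_filter -sum1_count big_enum_cond/=.
  rewrite sum1_card (eq_card (B := [predX predC1 k0 & predT])).
    by rewrite cardX cardC1 card_bool mulnC.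
  by move=> [k b]; rewrite !inE andbT.
have K0 : (0 < #|K|)%N by apply/card_gt0P; exists k0.
have szI : (2 * #|K|.-1 <= #|{: J * bool}|)%N.
  by rewrite card_prod card_bool mulnC leq_mul2r /= -ltnS prednK.
have sth0 : 0 <= s * th by rewrite mulr_ge0// ltW.
have [F' [mF' FF' PF']] := @near_span_tail R (s * th) (H / s) _ _ T P _ _ vs sth0 svs szI iR.
apply: (@le_trans _ _ (P F')).
  apply: le_measure; rewrite ?inE//; first exact: (measurable_section _ iG mF).
  move=> w2 [q hq]; apply: FF'.
  have := small_distance_near_span s0 hq; congr near_span.
    rewrite /vs; apply/eq_in_map => l; rewrite mem_filter => /andP[lk0 _].
    by apply/funext => -[j b]; rewrite /row_vec /x1/=; rewrite lk0.
  by apply/funext => -[j b]; rewrite /= eqxx.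
apply: le_trans PF' _; rewrite lee_fin.
have -> : s * th * (H / s) / 2 = th * H / 2 by field; rewrite gt_eqF.
(* The dimension left is [2 * #|J|] real coordinates minus two real vectors for each row other than
   [k0]. *)
have -> : (#|{: J * bool}| - 2 * #|K|.-1 = 2 * (#|J|.+1 - #|K|))%N.
  by rewrite card_prod card_bool mulnC -mulnBr -subSS prednK.
by [].
Qed.

(* Compare the conditional probabilities of [leverage] given the block [Some j] and given the
   column [None]. *)
Lemma small_eig_tail J (X : L * option J -> T -> R) (k0 : K) (s th y : R) :
  iid_normal P X -> 0 < s -> 0 < th < 1 -> 0 <= y -> (#|K| <= #|J|.+1)%N ->
  (P [set w | small_eig y (fun j l => X (l, Some j) w)]
   <= (expR (s * y / 2) * ((Num.sqrt (1 - th))^-1 ^+ (2 * #|K|)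
       * (Num.sqrt (1 + s * th))^-1 ^+ (2 * (#|J|.+1 - #|K|))))%:E)%E.
Proof.
move=> iX s0 /andP[th0 th1] y0 KJ.
set C := (Num.sqrt (1 + s * th))^-1 ^+ _.
have C0 : 0 <= C by rewrite exprn_ge0// invr_ge0 sqrtr_ge0.
have mX := proj1 iX.
pose V := rvec R (L * option J)%type.
pose F : set V := [set x | leverage s (fun l => (x : L * option J -> R) (l, None))
  (fun j l => (x : L * option J -> R) (l, Some j))].
have mF : measurable F.
  apply: (@measurable_leverage R K _ V J s (fun l x => (x : L * option J -> R) (l, None))
    (fun j l x => (x : L * option J -> R) (l, Some j))).
    by move=> l; exact: measurable_coord.
  by move=> j l; exact: measurable_coord.
have hi : injective (fun l : L => (l, None : option J)) by move=> l l' [].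
have iH := iid_normal_sub hi iX.
have gi : injective (fun p : L * J => (p.1, Some p.2)) by move=> [l j] [l' j'] [-> ->].
have iY := iid_normal_sub gi iX.
pose S w := \sum_(l : L) X (l, None) w ^+ 2.
have mS : measurable_fun [set: T] S.
  by apply: measurable_sum => l; exact: measurable_funX.
(* Given the column, [leverage_tail] applies; averaging over the column is a Gaussian exponential
   moment, finite because [th < 1]. *)
have upper : (P [set w | F (X ^~ w)]
    <= ((Num.sqrt (1 - th))^-1 ^+ (2 * #|K|) * C)%:E)%E.
  pose c w : \bar R := (expR (th * S w / 2) * C)%:E.
  have me : measurable_fun [set: T] (fun w => (expR (th * S w / 2))%:E).
    apply/measurable_EFinP; apply: measurableT_comp; first exact: measurable_expR.
    by apply: measurable_funM => //; apply: measurable_funM.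
  have mc : measurable_fun [set: T] c.
    apply/measurable_EFinP; apply: measurable_funM => //.
    by apply/measurable_EFinP; exact: me.
  have := @conditional_le _ _ _ _ _ (fun p : L * option J => p.2 == None) X F iX mF c mc.
  have -> : (\int[P]_w c w = ((Num.sqrt (1 - th))^-1 ^+ (2 * #|K|) * C)%:E)%E.
    rewrite /c; under eq_integral do rewrite EFinM.
    have e0 w : [set: T] w -> (0 <= (expR (th * S w / 2))%:E)%E.
      by move=> _; rewrite lee_fin expR_ge0.
    have C0' : (0 <= C%:E)%E by rewrite lee_fin.
    rewrite (ge0_integralZr P measurableT me e0 C0') EFinM; congr (_ * _)%E.
    have a1 : -1 < - th by rewrite ltrN2.
    rewrite mulnC -[X in (#|K| * X)%N]card_bool -card_prod -(sumsq_laplace a1 iH).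
    by apply: eq_integral => w _; congr (expR _)%:E; rewrite [X in - X](mulNr th) opprK.
  apply => w1; rewrite /c.
  exact: (leverage_tail k0 (fun l => X (l, None) w1) iY s0 (ltW th0) KJ).
pose B := [set w | small_eig y (fun j l => X (l, Some j) w)].
have mB : measurable B.
  by apply: (@measurable_small_eig R K _ T J y (fun j l => X (l, Some j))).
(* Given the block, a witness [q] of a small eigenvalue is fixed, and the fresh column reaches the
   level [s * y * |u|^2] on it with probability [expR (- (s * y / 2))]. *)
have lower : ((expR (- (s * y / 2)))%:E * P B <= P [set w | F (X ^~ w)])%E.
  pose c w : \bar R := ((expR (- (s * y / 2)))%:E * (\1_B w)%:E)%E.
  have m1 : measurable_fun [set: T] (fun w => (\1_B w)%:E : \bar R).
    by apply/measurable_EFinP; exact: measurable_indic.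
  have mc : measurable_fun [set: T] c by exact: emeasurable_funM.
  have c0 w : (0 <= c w)%E by rewrite mule_ge0// lee_fin ?expR_ge0.
  have := @conditional_ge _ _ _ _ _ (fun p : L * option J => p.2 != None) X F iX mF c mc c0.
  have -> : (\int[P]_w c w = (expR (- (s * y / 2)))%:E * P B)%E.
    have k0' : (0 <= (expR (- (s * y / 2)))%:E)%E by rewrite lee_fin expR_ge0.
    have i0 w : [set: T] w -> (0 <= (\1_B w)%:E :> \bar R)%E by rewrite lee_fin.
    by rewrite (ge0_integralZl P measurableT m1 i0 k0') integral_indic// setIT.
  apply => w1; rewrite /c indicE.
  have [|_] := boolP (w1 \in B); last by rewrite mule0.
  rewrite inE mule1 => -[q hq].
  set u := of_rat R q in hq.
  have u0 : 0 < \sum_l u l ^+ 2.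
    rewrite lt_neqAle eq_sym sumr_ge0 ?andbT; last by move=> l _; exact: sqr_ge0.
    apply/eqP => u0; move: hq; rewrite u0 mulr0 ltNge sumr_ge0// => j _; exact: cabs2_ge0.
  have z0 : 0 <= s * y / 2 by rewrite divr_ge0// mulr_ge0// ltW.
  rewrite -(cabs2_upper_tail k0 iH z0 u0).
  have msec := @measurable_section _ _ _ _ _ (fun p : L * option J => p.2 != None) X F iX mF w1.
  apply: le_measure; rewrite ?inE//.
    have mcab : measurable_fun [set: T] (fun w => cabs2 (fun l => X (l, None) w) u).
      by apply: measurable_cabs2.
    have -> : [set w | 2 * (s * y / 2) * \sum_l u l ^+ 2 <= cabs2 (fun l => X (l, None) w) u]
      = [set: T] `&` (fun w => cabs2 (fun l => X (l, None) w) u) @^-1`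
          `[2 * (s * y / 2) * \sum_l u l ^+ 2, +oo[.
      by apply/seteqP; split=> w /=; rewrite in_itv/= andbT; [|case].
    exact: mcab.
  move=> w2 /= H; exists q; apply: lt_le_trans H.
  have -> : 2 * (s * y / 2) * \sum_l u l ^+ 2 = s * (y * \sum_l u l ^+ 2) by field.
  by rewrite ltr_pM2l.
rewrite EFinM; have := le_trans lower upper.
rewrite -(lee_pmul2l (x := (expR (s * y / 2))%:E)) ?lte_fin ?expR_gt0//.
rewrite muleA; congr (_ <= _)%E.
have -> : ((expR (s * y / 2))%:E * (expR (- (s * y / 2)))%:E = 1)%E.
  by rewrite -EFinM -expRD subrr expR0.
by rewrite mul1e.
Qed.

End least_eigenvalue_tail.

(** * Numerical exponent of the eigenvalue tail *)

Section exponents.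
Variable R : realType.

Lemma expR_le_inv (x : R) : x < 1 -> expR x <= (1 - x)^-1.
Proof.
move=> x1; have x0 : 0 < 1 - x by rewrite subr_gt0.
rewrite -[x]opprK expRN opprK lef_pV2 ?posrE ?expR_gt0//.
by have := expR_ge1Dx (- x).
Qed.

(** This follows from [e^(1/20) <= 20/19] and [(20/19)^21 <= 3]. *)
Lemma expR_21_20_le3 : expR (21 / 20) <= 3 :> R.
Proof.
have E : expR (1 / 20) <= 20 / 19 :> R.
  have <- : (1 - 1 / 20)^-1 = 20 / 19 :> R by field.
  by apply: expR_le_inv; lra.
have -> : 21 / 20 = 21%:R * (1 / 20) :> R by lra.
rewrite expRM_natl.
apply: (@le_trans _ _ ((20 / 19 : R) ^+ 21)).
  by apply: lerXn2r; rewrite ?nnegrE ?expR_ge0//; lra.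
lra.
Qed.

(** The case [th = eta], [s = 2 / eta] with [eta = 1 - q], in dimension [n - 1], so that
    [1 - th = q] and [1 + s * th = 3]. As [n = q^2 * m], the exponents in units of [(1 - q) * m] are
    at most [51/50], [q] and [- 21/20 * (1 + q)], with sum at most [- 3/100]. *)
Lemma eig_exponent (n m : nat) (q : R) : (0 < n)%N -> (n < m)%N ->
  q = Num.sqrt (n%:R / m%:R) ->
  expR (51 / 50 * (1 - q) * m%:R) *
    ((Num.sqrt (1 - (1 - q)))^-1 ^+ (2 * n.-1)
     * (Num.sqrt (1 + 2 / (1 - q) * (1 - q)))^-1 ^+ (2 * (m.+1 - n.-1)))
  <= expR (- (3 / 100 * (1 - q) * m%:R)).
Proof.
move=> n0 nm qE; have m0 : (0 < m)%N by exact: ltn_trans nm.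
have n0R : 0 < n%:R :> R by rewrite ltr0n.
have m0R : 0 < m%:R :> R by rewrite ltr0n.
have q0 : 0 < q by rewrite qE sqrtr_gt0 divr_gt0.
have q2 : q ^+ 2 = n%:R / m%:R by rewrite qE sqr_sqrtr// ltW// divr_gt0.
have q1 : q < 1.
  by rewrite -(@ltr_pXn2r _ 2) ?nnegrE ?(ltW q0)// q2 expr1n ltr_pdivrMr// mul1r ltr_nat.
have nE : n%:R = q ^+ 2 * m%:R :> R by rewrite q2 divfK// gt_eqF.
have e0 : 0 < 1 - q by rewrite subr_gt0.
have -> : 1 - (1 - q) = q by ring.
have -> : 1 + 2 / (1 - q) * (1 - q) = 3 by rewrite divfK ?gt_eqF//; lra.
have F1 : (Num.sqrt q)^-1 ^+ (2 * n.-1) <= expR (q * (1 - q) * m%:R).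
  rewrite exprM exprVn sqr_sqrtr ?(ltW q0)//.
  have qV1 : 1 <= q^-1 by rewrite invf_ge1// ltW.
  apply: (@le_trans _ _ (q^-1 ^+ n)).
    by apply: ler_weXn2l => //; exact: leq_pred.
  have -> : q * (1 - q) * m%:R = n%:R * (q^-1 - 1).
    by rewrite nE; field; rewrite gt_eqF.
  rewrite expRM_natl; apply: lerXn2r; rewrite ?nnegrE ?expR_ge0 ?invr_ge0 ?(ltW q0)//.
  by apply: le_trans (expR_ge1Dx _); rewrite addrC subrK.
have F2 : (Num.sqrt 3)^-1 ^+ (2 * (m.+1 - n.-1)) <= expR (- (21 / 20 * ((1 - q) * (1 + q) * m%:R))).
  rewrite exprM exprVn sqr_sqrtr//.
  have -> : - (21 / 20 * ((1 - q) * (1 + q) * m%:R)) = (m - n)%:R * - (21 / 20) :> R.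
    by rewrite natrB 1?ltnW// nE; ring.
  rewrite expRM_natl; apply: (@le_trans _ _ (3^-1 ^+ (m - n))).
    apply: ler_wiXn2l; rewrite ?invr_ge0//; first by rewrite invf_le1//; lra.
    by apply: leq_sub; [exact: leqnSn|exact: leq_pred].
  apply: lerXn2r; rewrite ?nnegrE ?expR_ge0 ?invr_ge0//.
  by rewrite expRN lef_pV2 ?posrE ?expR_gt0//; exact: expR_21_20_le3.
apply: (@le_trans _ _ (expR (51 / 50 * (1 - q) * m%:R) * (expR (q * (1 - q) * m%:R)
   * expR (- (21 / 20 * ((1 - q) * (1 + q) * m%:R)))))).
  rewrite ler_pM2l ?expR_gt0//; apply: ler_pM => //;
    by rewrite exprn_ge0// invr_ge0 sqrtr_ge0.
rewrite -!expRD ler_expR.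
have : 0 <= q * ((1 - q) * m%:R) by rewrite !mulr_ge0 ?(ltW q0) ?(ltW e0).
lra.
Qed.

End exponents.

(** * Order statistics of the intensities *)

Section order_statistics.
Context d (T : measurableType d) (R : realType) (P : probability T R).
Variables (J : finType) (X : bool * J -> T -> R).
Hypothesis iX : iid_normal P X.

Definition intensity (j : J) (w : T) : R := X (false, j) w ^+ 2 + X (true, j) w ^+ 2.

Lemma measurable_intensity j : measurable_fun [set: T] (intensity j).
Proof. by apply: measurable_funD; apply: measurable_funX; case: iX. Qed.

Lemma intensity_tail j z : 0 <= z ->
  P [set w | 2 * z <= intensity j w] = (expR (- z))%:E.
Proof.
move=> z0.
pose D := [set p : R * R | 2 * z <= p.1 ^+ 2 + p.2 ^+ 2].
have mD : measurable D.
  have -> : D = [set: R * R] `&` (fun p : R * R => p.1 ^+ 2 + p.2 ^+ 2) @^-1` `[2 * z, +oo[.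
    by apply/seteqP; split=> x /=; rewrite in_itv/= andbT; [|case].
  have mf : measurable_fun [set: R * R] (fun p : R * R => p.1 ^+ 2 + p.2 ^+ 2).
    by apply: measurable_funD; apply: measurable_funX.
  exact: mf.
have ft : (false, j) != (true, j) by rewrite xpair_eqE.
by rewrite -(normal_pair_radial z0) -/D -(iid_normal_pair ft iX mD).
Qed.

Lemma measurable_intensity_ge j (v : R) : measurable [set w | v <= intensity j w].
Proof.
have -> : [set w | v <= intensity j w] = [set: T] `&` intensity j @^-1` `[v, +oo[.
  by apply/seteqP; split=> x /=; rewrite in_itv/= andbT; [|case].
exact: measurable_intensity.
Qed.

(** Squeezed between two values of the exponential tail at distance [h], the atom has mass at most
    [h]. *)
Lemma intensity_atomless j v : P [set w | intensity j w = v] = 0%E.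
Proof.
have mE : measurable [set w | intensity j w = v].
  rewrite -[X in measurable X]setTI -[X in _ `&` X]/(intensity j @^-1` [set v]).
  exact: measurable_intensity.
have [v0|v0] := ltP v 0.
  rewrite (_ : [set w | _] = set0) ?measure0//; apply/seteqP; split=> w //= E.
  by move: v0; rewrite -E ltNge addr_ge0 ?sqr_ge0.
apply/eqP; rewrite eq_le measure_ge0 andbT; apply/lee_addgt0Pr => h h0; rewrite add0e.
have vE : 2 * (v / 2) = v by field.
have z0 : 0 <= v / 2 by rewrite divr_ge0.
have zh0 : 0 <= v / 2 + h by rewrite addr_ge0// ltW.
have := intensity_tail j z0; have := intensity_tail j zh0.
set B := [set w | 2 * (v / 2 + h) <= _]; set A := [set w | 2 * (v / 2) <= _] => PB PA.
have mA : measurable A by exact: measurable_intensity_ge.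
have mB : measurable B by exact: measurable_intensity_ge.
have : (P [set w | intensity j w = v] + P B <= P A)%E.
  rewrite -measureU//; last first.
    apply/seteqP; split=> w //= -[E]; rewrite /B/= E mulrDr vE.
    by rewrite gerDl leNgt mulr_gt0.
  apply: le_measure; rewrite ?inE//; first exact: measurableU.
  move=> w /= [E|]; rewrite /A/= vE; first by rewrite E.
  by apply: le_trans; rewrite mulrDr vE lerDl mulr_ge0// ltW.
rewrite PA PB -leeBrDr// -EFinB => H; apply: le_trans H _; rewrite lee_fin.
rewrite opprD expRD -[X in X - _]mulr1 -mulrBr.
have e1 : 1 - expR (- h) <= h by have := expR_ge1Dx (- h); lra.
have e2 : expR (- (v / 2)) <= 1 by rewrite -[leRHS]expR0 ler_expR oppr_le0.
have e3 : 0 <= 1 - expR (- h) by rewrite subr_ge0 -[X in _ <= X]expR0 ler_expR oppr_le0 ltW.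
apply: le_trans e1; rewrite -[leRHS]mul1r ler_wpM2r//.
Qed.

(** Chernoff bound for [rho ^+ cnt w]: each column contributes a factor
    [rho + (1 - rho) * expR (- tau)] to the expectation, at most [expR (- ((1 - rho) * (1 - expR (-
    tau))))]. *)
Lemma few_small_intensities (m : nat) (tau rho : R) : 0 <= tau -> 0 < rho < 1 ->
  (P [set w | (#|[pred j | (intensity j w < 2 * tau)%R]| < m)%N]
   <= (rho^-1 ^+ m * expR (- ((1 - rho) * (1 - expR (- tau)) * #|J|%:R)))%:E)%E.
Proof.
move=> tau0 /andP[rho0 rho1].
pose cnt w := #|[pred j | (intensity j w < 2 * tau)%R]|.
pose V := rvec R (bool * J)%type.
pose A j := [set w | 2 * tau <= intensity j w].
pose f (j : J) (x : V) : \bar R :=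
  (rho + (1 - rho) * \1_[set x : V | 2 * tau <=
     (x : bool * J -> R) (false, j) ^+ 2 + (x : bool * J -> R) (true, j) ^+ 2] x)%:E.
have mf j : measurable_fun [set: V] (f j).
  apply/measurable_EFinP; apply: measurable_funD; first exact: measurable_cst.
  apply: measurable_funM; first exact: measurable_cst.
  apply: measurable_indic.
  have mg : measurable_fun [set: V] (fun x : V => (x : bool * J -> R) (false, j) ^+ 2
     + (x : bool * J -> R) (true, j) ^+ 2).
    by apply: measurable_funD; apply: measurable_funX; exact: measurable_coord.
  rewrite (_ : [set x | _] = [set: V] `&` (fun x : V => (x : bool * J -> R) (false, j) ^+ 2
     + (x : bool * J -> R) (true, j) ^+ 2) @^-1` `[2 * tau, +oo[).
    exact: mg.
  by apply/seteqP; split=> x /=; rewrite in_itv/= andbT; [|case].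
have f0 j x : (0 <= f j x)%E.
  by rewrite lee_fin addr_ge0 ?(ltW rho0)// mulr_ge0// subr_ge0 ltW.
have fb j (x y : bool * J -> R) : (forall i, i.2 = j -> x i = y i) -> f j x = f j y.
  move=> xy; rewrite /f !indicE; congr (rho + (1 - rho) * (nat_of_bool _)%:R)%:E.
  by apply/idP/idP; rewrite !inE /= !xy.
have fE j w : f j (X ^~ w) = (if intensity j w < 2 * tau then rho else 1)%:E.
  rewrite /f indicE; congr EFin; case: ltP => h.
    rewrite memNset ?mulr0 ?addr0//= => h'.
    by move: h; rewrite ltNge h'.
  by rewrite mem_set ?mulr1 ?[rho + _]addrC ?subrK.
have prodE w : (\prod_(j <- index_enum J) f j (X ^~ w) = (rho ^+ cnt w)%:E)%E.
  under eq_bigr do rewrite fE.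
  by rewrite prodEFin -big_mkcond/= prodr_const.
have := expectation_block_prod (b := snd) (f := f) iX (index_enum_uniq J) mf f0 fb.
have E1 j : (\int[P]_w f j (X ^~ w) = (rho + (1 - rho) * expR (- tau))%:E)%E.
  have mA : measurable (A j) by exact: measurable_intensity_ge.
  have m1 : measurable_fun [set: T] (fun w => (\1_(A j) w)%:E : \bar R).
    by apply/measurable_EFinP; exact: measurable_indic.
  have i0 w : [set: T] w -> (0 <= (\1_(A j) w)%:E :> \bar R)%E by rewrite lee_fin.
  have r0 : (0 <= (1 - rho)%:E)%E by rewrite lee_fin subr_ge0 ltW.
  transitivity (\int[P]_w (rho%:E + (1 - rho)%:E * (\1_(A j) w)%:E))%E.
    apply: eq_integral => w _; rewrite /f EFinD EFinM !indicE.
    congr (_ + _ * (nat_of_bool _)%:R%:E)%E.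
  pose f1 (_ : T) : \bar R := rho%:E.
  pose f2 w : \bar R := ((1 - rho)%:E * (\1_(A j) w)%:E)%E.
  have f10 w : [set: T] w -> (0 <= f1 w)%E by rewrite lee_fin ltW.
  have f20 w : [set: T] w -> (0 <= f2 w)%E by move=> ?; rewrite mule_ge0// i0.
  have mf1 : measurable_fun [set: T] f1 by exact: measurable_cst.
  have mf2 : measurable_fun [set: T] f2 by exact: emeasurable_funM.
  rewrite -[LHS]/(\int[P]_w (f1 w + f2 w))%E (ge0_integralD P measurableT f10 mf1 f20 mf2).
  rewrite /f1 integral_cst// (ge0_integralZl P measurableT m1 i0 r0) integral_indic// setIT.
  have PA : P (A j) = (expR (- tau))%:E by exact: intensity_tail.
  transitivity (rho%:E * 1 + (1 - rho)%:E * (expR (- tau))%:E)%E; last by rewrite mule1.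
  by congr (_ * _ + _ * _)%E; [exact: probability_setT|exact: PA].
under eq_integral do rewrite prodE.
under eq_bigr do rewrite E1.
rewrite prodEFin prodr_const => E.
pose g w : \bar R := (rho ^+ cnt w)%:E.
have mg : measurable_fun [set: T] g.
  rewrite (_ : g = fun w => \prod_(j <- index_enum J) f j (X ^~ w))%E; last first.
    by apply/funext => w; rewrite prodE.
  elim: (index_enum J) => [|j s IH].
    rewrite (_ : (fun w => _) = cst 1%E); first exact: measurable_cst.
    by apply/funext => w; rewrite big_nil.
  rewrite (_ : (fun w => _) = (fun w => f j (X ^~ w) * \prod_(k <- s) f k (X ^~ w))%E).
    apply: emeasurable_funM => //.
    by apply: (measurableT_comp (mf j)); apply: measurable_rvec; case: iX.
  by apply/funext => w; rewrite big_cons.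
have g0 w : (0 <= g w)%E by rewrite lee_fin exprn_ge0// ltW.
have -> : [set w | (cnt w < m)%N] = [set w | ((rho ^+ m)%:E < g w)%E].
  by apply/seteqP; split=> w /=; rewrite /g lte_fin ltr_iXn2l.
set B := [set w | _].
have mB : measurable B.
  rewrite (_ : B = [set: T] `&` [set w | ((rho ^+ m)%:E < g w)%E]); last by rewrite setTI.
  exact: emeasurable_fun_o_infty.
have rm0 : (0 <= (rho^-1 ^+ m)%:E :> \bar R)%E by rewrite lee_fin exprn_ge0// invr_ge0 ltW.
apply: (@le_trans _ _ (\int[P]_w ((rho^-1 ^+ m)%:E * g w))%E).
  rewrite -[X in P X]setIT -(integral_indic P measurableT mB).
  apply: ge0_le_integral => //.
  - by apply/measurable_EFinP; exact: measurable_indic.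
  - exact: emeasurable_funM.
  - move=> w _; rewrite indicE; have [|_] := boolP (w \in B); last by rewrite mule_ge0.
    rewrite inE /B/= /g lte_fin -EFinM lee_fin exprVn mulrC => H.
    by rewrite ler_pdivlMr ?exprn_gt0// mul1r ltW.
rewrite (ge0_integralZl P measurableT mg (fun w _ => g0 w) rm0) E -EFinM lee_fin.
rewrite ler_wpM2l ?exprn_ge0 ?invr_ge0 ?(ltW rho0)//.
have -> : - ((1 - rho) * (1 - expR (- tau)) * #|J|%:R)
    = #|J|%:R * - ((1 - rho) * (1 - expR (- tau))) by ring.
rewrite expRM_natl; apply: lerXn2r; rewrite ?nnegrE ?expR_ge0//.
  by rewrite addr_ge0 ?(ltW rho0)// mulr_ge0 ?expR_ge0// subr_ge0 ltW.
apply: le_trans (expR_ge1Dx _).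
by rewrite le_eqVlt; apply/orP; left; apply/eqP; ring.
Qed.

(** With column [j] fixed, a tie asks [intensity i] to hit a given value. *)
Lemma intensity_ties (i j : J) : i != j -> P [set w | intensity i w = intensity j w] = 0%E.
Proof.
move=> ij; pose V := rvec R (bool * J)%type.
pose h (k : J) (x : V) := (x : bool * J -> R) (false, k) ^+ 2 + (x : bool * J -> R) (true, k) ^+ 2.
have mh k : measurable_fun [set: V] (h k).
  by apply: measurable_funD; apply: measurable_funX; exact: measurable_coord.
pose F : set V := [set x | h i x = h j x].
have mF : measurable F.
  rewrite (_ : F = [set: V] `&` (fun x => h i x - h j x) @^-1` [set 0]).
    by apply: measurable_funB.
  apply/seteqP; split=> x; rewrite /F/=; first by move=> ->; rewrite subrr.
  by move=> [_ /eqP]; rewrite subr_eq0 => /eqP.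
apply/eqP; rewrite eq_le measure_ge0 andbT.
apply: (conditional_le_cst (A := fun p : bool * J => p.2 == j) iX mF) => w1.
rewrite -[X in (_ <= X)%E](intensity_atomless i (intensity j w1)).
rewrite le_eqVlt; apply/orP; left; apply/eqP; congr (P _).
by apply/seteqP; split=> w2; rewrite /F /h /intensity/= eqxx (negbTE ij).
Qed.

End order_statistics.

(** * The null vector *)

Section null_vector.
Variables (R : realType) (K J : finType).
Notation L := (K * bool)%type.
Implicit Types v w u x z : L -> R.

Definition nrm2 v : R := \sum_l v l ^+ 2.
Definition dot v w : R := \sum_l v l * w l.
Definition comb (a b : R) v w : L -> R := fun l => a * v l + b * w l.

Lemma dot_comb v (a b : R) w u : dot v (comb a b w u) = a * dot v w + b * dot v u.
Proof. by rewrite /dot !mulr_sumr -big_split/=; apply: eq_bigr => l _; rewrite /comb; ring. Qed.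

Lemma imul_comb (a b : R) v w : imul (comb a b v w) = comb a b (imul v) (imul w).
Proof. by apply/funext => -[k b']; rewrite /imul /comb/=; case: b' => /=; ring. Qed.

Lemma imulK v : imul (imul v) = comb (-1) 0 v v.
Proof. by apply/funext => -[k b']; rewrite /imul /comb/=; case: b' => /=; ring. Qed.

Lemma nrm2_comb (a b : R) v w :
  nrm2 (comb a b v w) = a ^+ 2 * nrm2 v + 2 * a * b * dot v w + b ^+ 2 * nrm2 w.
Proof.
by rewrite /nrm2 /dot !mulr_sumr -!big_split/=; apply: eq_bigr => l _; rewrite /comb; ring.
Qed.

Lemma nrm2_imul v : nrm2 (imul v) = nrm2 v.
Proof.
rewrite /nrm2 !sum_pair_bool; apply: eq_bigr => k _.
by rewrite /imul/= sqrrN addrC.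
Qed.

Lemma dot_imul_self v : dot v (imul v) = 0.
Proof. by rewrite /dot dot_imul big1// => k _; rewrite mulrC subrr. Qed.

Lemma nrm2_ge0 v : 0 <= nrm2 v.
Proof. by apply: sumr_ge0 => l _; exact: sqr_ge0. Qed.

Lemma cabs2E v w : cabs2 v w = dot v w ^+ 2 + dot v (imul w) ^+ 2.
Proof. by []. Qed.

Variables (G : J -> L -> R) (S : pred J).

Definition energy v : R := \sum_(j | S j) cabs2 (G j) v.

(** The real bilinear form that polarizes [energy]. *)
Let B v w : R := \sum_(j | S j)
  (dot (G j) v * dot (G j) w + dot (G j) (imul v) * dot (G j) (imul w)).

Lemma energy_ge0 v : 0 <= energy v.
Proof. by apply: sumr_ge0 => j _; exact: cabs2_ge0. Qed.

Let energy_comb (a b : R) v w :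
  energy (comb a b v w) = a ^+ 2 * energy v + 2 * a * b * B v w + b ^+ 2 * energy w.
Proof.
rewrite /energy /B !mulr_sumr -!big_split/=; apply: eq_bigr => j _.
by rewrite !cabs2E imul_comb !dot_comb; ring.
Qed.

Lemma energy_phase (c s : R) v : c ^+ 2 + s ^+ 2 = 1 ->
  energy (comb c s v (imul v)) = energy v.
Proof.
move=> cs; apply: eq_bigr => j _.
rewrite !cabs2E imul_comb imulK !dot_comb.
transitivity ((c ^+ 2 + s ^+ 2) * (dot (G j) v ^+ 2 + dot (G j) (imul v) ^+ 2)); first by ring.
by rewrite cs mul1r.
Qed.

(** The form is diagonal for [x] and [z = x0 - tau * x], while [x0 = z + tau * x] and
    [u = (1 - tau^2) * x - tau * z]. Minimality gives [(1 - tau^2) * energy x <= energy z], hence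
    [energy u <= energy z <= energy x0]. *)
Lemma null_vector_real (x0 x : L -> R) (y : R) :
  0 < nrm2 x0 -> nrm2 x = nrm2 x0 -> (forall z, nrm2 z = nrm2 x0 -> energy x <= energy z) ->
  dot x0 (imul x) = 0 ->
  (forall u, dot x0 u = 0 -> dot x0 (imul u) = 0 -> y * nrm2 u <= energy u) ->
  y * (nrm2 x0 ^+ 2 - dot x0 x ^+ 2) <= nrm2 x0 * energy x0.
Proof.
set r := nrm2 x0; set p := dot x0 x => r0 nx xmin x0ix hu.
have rn : r != 0 by rewrite gt_eqF.
pose tau := p / r.
pose z := comb 1 (- tau) x0 x.
pose u := comb 1 (- tau) x x0.
have pC : dot x x0 = p by rewrite /p /dot; apply: eq_bigr => l _; rewrite mulrC.
have zE : nrm2 z = r * (1 - tau ^+ 2).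
  by rewrite /z nrm2_comb nx -/r -/p /tau; field.
have uE : nrm2 u = r * (1 - tau ^+ 2).
  by rewrite /u nrm2_comb nx pC -/r /tau; field.
have -> : r ^+ 2 - p ^+ 2 = r * (r * (1 - tau ^+ 2)) by rewrite /tau; field.
rewrite mulrCA ler_pM2l//.
have [z0|z0] := eqVneq (nrm2 z) 0.
  by rewrite -zE z0 mulr0; exact: energy_ge0.
have zpos : 0 < nrm2 z by rewrite lt_neqAle eq_sym z0 nrm2_ge0.
have e0 : 0 < 1 - tau ^+ 2 by move: zpos; rewrite zE pmulr_rgt0.
have xz : dot x z = 0.
  by rewrite /z dot_comb pC -[dot x x]/(nrm2 x) nx -/r /tau; field.
(* Minimality of [x] against [x + t * z] rescaled to the sphere; the squared norm has no linear term
   as [x] and [z] are orthogonal. *)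
have H t : 0 <= 2 * t * (r * B x z) + t ^+ 2 * (r * energy z - nrm2 z * energy x).
  pose v := comb 1 t x z.
  have nv : nrm2 v = r + t ^+ 2 * nrm2 z.
    by rewrite /v nrm2_comb xz nx -/r; ring.
  have nv0 : 0 < nrm2 v by rewrite nv ltr_wpDr// mulr_ge0 ?sqr_ge0// ltW.
  pose w := comb (Num.sqrt (r / nrm2 v)) 0 v v.
  have s2 : Num.sqrt (r / nrm2 v) ^+ 2 = r / nrm2 v by rewrite sqr_sqrtr// ltW// divr_gt0.
  have nw : nrm2 w = r.
    by rewrite /w nrm2_comb s2; field; rewrite gt_eqF.
  have := xmin w nw; rewrite /w energy_comb s2.
  have -> : r / nrm2 v * energy v + 2 * Num.sqrt (r / nrm2 v) * 0 * B v v + 0 ^+ 2 * energy v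
    = r * energy v / nrm2 v by ring.
  rewrite ler_pdivlMr// nv /v energy_comb -subr_ge0; congr (0 <= _).
  ring.
pose D := r * energy z - nrm2 z * energy x.
have D0 : 0 <= D.
  have h1 := H 1; have h2 := H (-1).
  by rewrite /D; move: h1 h2; rewrite !(mulr1, mulrN1) expr1n sqrrN expr1n !mul1r; lra.
have B0 : B x z = 0.
  apply/eqP; rewrite -(mulrI_eq0 _ (mulfI rn)) -sqrf_eq0 eq_le sqr_ge0 andbT.
  (* A value of [t] close to the minimizer of the quadratic; [D + 1] in place of [D] covers
     [D = 0]. *)
  have := H (- (r * B x z) / (D + 1)); rewrite -/D.
  have D1 : 0 < D + 1 by rewrite ltr_wpDl.
  have -> : 2 * (- (r * B x z) / (D + 1)) * (r * B x z) + (- (r * B x z) / (D + 1)) ^+ 2 * D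
    = - ((r * B x z) ^+ 2 * ((D + 2) / (D + 1) ^+ 2)) by field; rewrite gt_eqF.
  rewrite oppr_ge0 pmulr_lle0// divr_gt0 ?exprn_gt0//; lra.
have x0E : x0 = comb 1 tau z x.
  by apply/funext => l; rewrite /z /comb; ring.
have uzE : u = comb (1 - tau ^+ 2) (- tau) x z.
  by apply/funext => l; rewrite /u /z /comb; ring.
have Bzx : B z x = 0 by rewrite -B0 /B; apply: eq_bigr => j _; ring.
have Qx0 : energy x0 = energy z + tau ^+ 2 * energy x.
  by rewrite [in LHS]x0E energy_comb Bzx; ring.
have Qu : energy u = (1 - tau ^+ 2) ^+ 2 * energy x + tau ^+ 2 * energy z.
  by rewrite uzE energy_comb B0; ring.
have dxx : dot x0 x0 = r by [].
have hu1 : dot x0 u = 0.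
  by rewrite /u dot_comb -/p dxx /tau; field.
have hu2 : dot x0 (imul u) = 0.
  by rewrite /u imul_comb dot_comb x0ix dot_imul_self; ring.
have := hu u hu1 hu2; rewrite uE => Hu.
apply: le_trans Hu _; rewrite Qu Qx0.
have h1 : (1 - tau ^+ 2) * energy x <= energy z.
  have : 0 <= r * (energy z - (1 - tau ^+ 2) * energy x).
    by move: D0; rewrite /D zE; congr (0 <= _); ring.
  by rewrite pmulr_rge0// subr_ge0.
have h2 : (1 - tau ^+ 2) * ((1 - tau ^+ 2) * energy x) <= (1 - tau ^+ 2) * energy z.
  by rewrite ler_pM2l.
have h3 : 0 <= tau ^+ 2 * energy x by rewrite mulr_ge0 ?sqr_ge0 ?energy_ge0.
rewrite expr2 -mulrA; move: h2 h3; set a := _ * (_ * _); set b := tau ^+ 2 * energy x.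
move=> h2 h3; apply: (@le_trans _ _ ((1 - tau ^+ 2) * energy z + tau ^+ 2 * energy z)).
  by rewrite lerD2r.
by rewrite -mulrDl subrK mul1r lerDl.
Qed.

(** A global phase, which changes neither norm nor energy, makes [x0^* x] real. *)
Lemma null_vector_bound (x0 x : L -> R) (y : R) :
  0 < nrm2 x0 -> nrm2 x = nrm2 x0 -> (forall z, nrm2 z = nrm2 x0 -> energy x <= energy z) ->
  (forall u, dot x0 u = 0 -> dot x0 (imul u) = 0 -> y * nrm2 u <= energy u) ->
  y * (nrm2 x0 ^+ 2 - cabs2 x0 x) <= nrm2 x0 * energy x0.
Proof.
move=> r0 nx xmin hu.
suff [c [s [cs cx]]] : exists c s : R, c ^+ 2 + s ^+ 2 = 1 /\
    c * dot x0 (imul x) = s * dot x0 x.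
  pose x' := comb c s x (imul x).
  have x'i : dot x0 (imul x') = 0.
    by rewrite /x' imul_comb imulK !dot_comb cx; ring.
  have nx' : nrm2 x' = nrm2 x0.
    rewrite /x' nrm2_comb nrm2_imul dot_imul_self -nx.
    transitivity ((c ^+ 2 + s ^+ 2) * nrm2 x); first by ring.
    by rewrite cs mul1r.
  have p2 : cabs2 x0 x = dot x0 x' ^+ 2.
    have : cabs2 x0 x = dot x0 x' ^+ 2 + dot x0 (imul x') ^+ 2.
      rewrite cabs2E /x' imul_comb imulK !dot_comb.
      transitivity ((c ^+ 2 + s ^+ 2) * (dot x0 x ^+ 2 + dot x0 (imul x) ^+ 2)); last by ring.
      by rewrite cs mul1r.
    by rewrite x'i expr0n addr0.
  rewrite p2; apply: null_vector_real => // z nz.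
  by rewrite /x' energy_phase//; exact: xmin.
have [c0|c0] := eqVneq (cabs2 x0 x) 0.
  exists 1, 0; split; first by rewrite expr1n expr0n addr0.
  move/eqP: c0; rewrite cabs2E paddr_eq0 ?sqr_ge0// !sqrf_eq0 => /andP[_ /eqP ->].
  by rewrite mulr0 mul0r.
pose h := Num.sqrt (cabs2 x0 x).
have h2 : h ^+ 2 = dot x0 x ^+ 2 + dot x0 (imul x) ^+ 2 by rewrite sqr_sqrtr ?cabs2_ge0.
have h0 : h != 0 by rewrite -sqrf_eq0 h2 -cabs2E.
exists (dot x0 x / h), (dot x0 (imul x) / h); split; last by ring.
by rewrite !expr_div_n -mulrDl -h2 divff// expf_neq0.
Qed.

End null_vector.

(** * Translation between [cvec] and flat real vectors *)

Section encoding.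
Variables (R : realType) (n : nat).

Definition flatten_cvec (x : cvec R n) (l : 'I_n * bool) : R :=
  if l.2 then x.2 l.1 else x.1 l.1.

Definition unflatten (u : 'I_n * bool -> R) : cvec R n :=
  (fun k => u (k, false), fun k => u (k, true)).

Lemma unflattenK u : flatten_cvec (unflatten u) = u.
Proof. by apply/funext => -[k []]. Qed.

Lemma cnorm2E x : cnorm2 x = nrm2 (flatten_cvec x).
Proof. by rewrite /cnorm2 /nrm2 sum_pair_bool. Qed.

Lemma cabs2_flattenE (a u : 'I_n * bool -> R) : cabs2 a u =
  (\sum_k (a (k, false) * u (k, false) + a (k, true) * u (k, true))) ^+ 2 +
  (\sum_k (a (k, true) * u (k, false) - a (k, false) * u (k, true))) ^+ 2.
Proof. by rewrite /cabs2 dot_imul sum_pair_bool. Qed.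

Lemma cdot_abs2E (a : 'I_n * bool -> R) x :
  cdot_abs2 (fun k => a (k, false)) (fun k => a (k, true)) x = cabs2 a (flatten_cvec x).
Proof.
rewrite cabs2_flattenE /cdot_abs2 /flatten_cvec/=; congr (_ + _).
(* The two imaginary parts differ by a sign, which squaring removes. *)
by rewrite -sqrrN -sumrN; congr (_ ^+ 2); apply: eq_bigr => k _; rewrite opprB.
Qed.

Lemma frob2_rank1_diffE (x y : cvec R n) :
  frob2_rank1_diff x y =
  cnorm2 x ^+ 2 + cnorm2 y ^+ 2 - 2 * cabs2 (flatten_cvec x) (flatten_cvec y).
Proof.
rewrite cabs2_flattenE /flatten_cvec /= /cnorm2 /frob2_rank1_diff.
rewrite !expr2 !big_distrlr/= -!big_split/= mulr_sumr -sumrB; apply: eq_bigr => k _.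
rewrite -!big_split/= mulr_sumr -sumrB; apply: eq_bigr => l _; ring.
Qed.

End encoding.

(** * Events indexed by countable or finite types *)

Section finite_unions.
Context d (T : measurableType d) (R : realType) (P : probability T R).

Lemma measurable_exists (A : countType) (F : A -> set T) :
  (forall a, measurable (F a)) -> measurable [set w | exists a, F a w].
Proof.
move=> mF; rewrite (_ : [set w | _] = \bigcup_a F a).
  by apply: countable_bigcupT_measurable => //; exact: countableP.
by apply/seteqP; split=> w => [[a H]|[a _ H]]; exists a.
Qed.

Lemma measurable_forall (A : finType) (F : A -> set T) :
  (forall a, measurable (F a)) -> measurable [set w | forall a, F a w].
Proof.
move=> mF; rewrite (_ : [set w | _] = \bigcap_(a in [set: A]) F a).
  by apply: fin_bigcap_measurable => //; exact: finite_finset.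
by apply/seteqP; split=> w /= H a; [move=> _; exact: H|exact: H].
Qed.

Lemma null_exists (A : finType) (F : A -> set T) :
  (forall a, measurable (F a)) -> (forall a, P (F a) = 0%E) ->
  P [set w | exists a, F a w] = 0%E.
Proof.
move=> mF F0.
have H (s : seq A) : measurable [set w | exists2 a, a \in s & F a w] /\
    P [set w | exists2 a, a \in s & F a w] = 0%E.
  elim: s => [|a s [mS PS]].
    rewrite (_ : [set w | _] = set0) ?measure0//; apply/seteqP; split=> w // -[a].
    by rewrite in_nil.
  have -> : [set w | exists2 b, b \in a :: s & F b w] =
      F a `|` [set w | exists2 b, b \in s & F b w].
    apply/seteqP; split=> w.
      by move=> [b]; rewrite in_cons => /predU1P[->|bs] Fb; [left|right; exists b].
    move=> [Fa|[b bs Fb]]; [exists a|exists b] => //; rewrite in_cons ?eqxx//.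
    by rewrite bs orbT.
  split; first exact: measurableU.
  apply/eqP; rewrite eq_le measure_ge0 andbT.
  apply: le_trans (measureU2 _ (mF a) mS) _.
  by rewrite [X in (X + _)%E]F0 [X in (_ + X)%E]PS adde0.
rewrite -(proj2 (H (enum A))); congr (P _).
by apply/seteqP; split=> w => [[a Fa]|[a _ Fa]]; exists a; rewrite ?mem_enum.
Qed.

End finite_unions.

(** * The eigenvalue event for the selected columns *)

Section null_vector_events.
Context d (T : measurableType d) (R : realType) (P : probability T R).
Variables (n N m : nat) (Z : ('I_n * bool) * 'I_N -> T -> R) (k0 : 'I_n).
Notation L := ('I_n * bool)%type.
Hypotheses (iZ : iid_normal P Z) (nm : (n < m)%N) (mN : (m < N)%N).

Let eta : R := 1 - Num.sqrt (n%:R / m%:R).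
Definition eig_level : R := 51 / 50 * eta ^+ 2 * m%:R.

Let n0 : (0 < n)%N. Proof. by case: (n) k0 => // -[]. Qed.
Let m0 : (0 < m)%N. Proof. exact: ltn_trans nm. Qed.

Let q_lt1 : Num.sqrt (n%:R / m%:R) < 1 :> R.
Proof.
rewrite -[ltRHS]sqrtr1 ltr_sqrt// ltr_pdivrMr ?ltr0n// mul1r ltr_nat//.
Qed.

Let q_gt0 : 0 < Num.sqrt (n%:R / m%:R) :> R.
Proof. by rewrite sqrtr_gt0 divr_gt0// ltr0n. Qed.

Let eta01 : 0 < eta < 1.
Proof. by rewrite /eta subr_gt0 q_lt1 /= gtrBl q_gt0. Qed.

(** The columns in [I] with the row [k0] removed: the action on vectors orthogonal to the axis. *)
Definition off_axis (I : {set 'I_N}) (x : L * 'I_N -> R)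
    (j : {j | j \in I}) (l : {k | k \in predC1 k0} * bool) : R :=
  x ((val l.1, l.2), val j).

Definition eig_tail : R := expR (- (3 / 100 * eta * m%:R)).

(** The auxiliary independent column is taken from a column [j0] of [Z] outside [I], available
    because [m < N]. *)
Lemma off_axis_tail (I : {set 'I_N}) : #|I| = m ->
  (P [set w | small_eig eig_level (off_axis (I := I) (Z ^~ w))] <= eig_tail%:E)%E.
Proof.
move=> cI.
have cK : #|{: {k | k \in predC1 k0}}| = n.-1 by rewrite card_sig cardC1 card_ord.
have cJ : #|{: {j | j \in I}}| = m by rewrite card_sig.
have [j0 j0I] : exists j0 : 'I_N, j0 \notin I.
  have /card_gt0P[j0] : (0 < #|~: I|)%N by rewrite cardsCs finset.setCK cI card_ord subn_gt0.
  by rewrite inE => ?; exists j0.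
have y0 : 0 <= eig_level by rewrite /eig_level mulr_ge0// mulr_ge0 ?sqr_ge0// divr_ge0.
(* For [n = 1] no row is left: the right-hand side of the inequality is 0 and the event is empty. *)
have [[k1 _]|nK] := pselect (exists k1 : {k | k \in predC1 k0}, true); last first.
  rewrite (_ : [set w | _] = set0); first by rewrite measure0 lee_fin expR_ge0.
  apply/seteqP; split=> w // -[q].
  rewrite [X in _ * X]big1; last by move=> [k b] _; case: nK; exists k.
  rewrite mulr0 ltNge sumr_ge0// => j _; exact: cabs2_ge0.
pose iota (p : ({k | k \in predC1 k0} * bool) * option {j | j \in I}) : L * 'I_N :=
  ((val p.1.1, p.1.2), if p.2 is Some j then val j else j0).
have iotaI : injective iota.
  move=> [[k b] j] [[k' b'] j'] [/val_inj -> -> ] /=.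
  case: j => [j|]; case: j' => [j'|] //=; first by move=> /val_inj ->.
    by move=> e; move: j0I; rewrite -e (valP j).
  by move=> e; move: j0I; rewrite e (valP j').
have iX := iid_normal_sub iotaI iZ.
have s0 : 0 < 2 / eta by rewrite divr_gt0//; case/andP: eta01.
have KJ : (#|{: {k | k \in predC1 k0}}| <= #|{: {j | j \in I}}|.+1)%N.
  by rewrite cK cJ (leq_trans (leq_pred _))// (leq_trans (ltnW nm)).
apply: le_trans (small_eig_tail k1 iX s0 eta01 y0 KJ) _.
rewrite lee_fin cK cJ /eig_tail.
have := eig_exponent n0 nm (erefl (Num.sqrt (n%:R / m%:R) : R)).
rewrite -/eta; congr (expR _ * _ <= _).
by rewrite /eig_level; field; rewrite gt_eqF//; case/andP: eta01.
Qed.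

Definition axis_row (p : bool * 'I_N) (w : T) : R := Z ((k0, p.1), p.2) w.

Lemma iid_axis_row : iid_normal P axis_row.
Proof.
have h : injective (fun p : bool * 'I_N => ((k0, p.1), p.2)) by move=> [b j] [b' j'] [-> ->].
exact: iid_normal_sub h iZ.
Qed.

Let q0 (j : 'I_N) (x : L * 'I_N -> R) : R :=
  x ((k0, false), j) ^+ 2 + x ((k0, true), j) ^+ 2.

(** This depends on the row [k0] only, and strictness leaves at most one such set. *)
Definition selected (I : {set 'I_N}) (x : L * 'I_N -> R) : Prop :=
  #|I| = m /\ forall i j, i \in I -> j \notin I -> q0 i x < q0 j x.

Lemma selected_unique I I' x : selected I x -> selected I' x -> I = I'.
Proof.
move=> [cI hI] [cI' hI']; apply/eqP; rewrite eqEcard cI cI' leqnn andbT.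
apply/fintype.subsetP => i iI; apply/negPn/negP => iI'.
have [j jI' jI] : exists2 j, j \in I' & j \notin I.
  have : ~~ (I' \subset I).
    apply: contra iI' => sub.
    have /eqP -> : I' == I by rewrite eqEcard sub cI cI' leqnn.
    exact: iI.
  by case/subsetPn => j; exists j.
by have := lt_trans (hI _ _ iI jI) (hI' _ _ jI' iI'); rewrite ltxx.
Qed.

Definition bad_selection : set (rvec R (L * 'I_N)%type) :=
  [set x | exists I : {set 'I_N}, selected I x /\ small_eig eig_level (off_axis (I := I) x)].

Lemma measurable_bad_selection : measurable bad_selection.
Proof.
apply: measurable_exists => I; apply: measurableI; last first.
  apply: (@measurable_small_eig R _ _ (rvec R (L * 'I_N)%type) _ eig_level
    (fun j l (x : rvec R (L * 'I_N)%type) => off_axis (I := I) x j l)) => j l.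
  exact: measurable_coord.
apply: measurableI.
  have [e|e] := pselect (#|I| = m).
    by rewrite [X in measurable X](_ : _ = setT)//; apply/seteqP; split.
  by rewrite [X in measurable X](_ : _ = set0)//; apply/seteqP; split.
have mq j : measurable_fun [set: rvec R (L * 'I_N)%type] (q0 j : rvec R (L * 'I_N)%type -> R).
  by apply: measurable_funD; apply: measurable_funX; exact: measurable_coord.
rewrite [X in measurable X](_ : _ = [set x | forall p : 'I_N * 'I_N,
    [set x | p.1 \in I -> p.2 \notin I -> q0 p.1 x < q0 p.2 x] x]); last first.
  by apply/seteqP; split=> x /= H; [move=> [i j]|move=> i j]; [exact: H|exact: (H (i, j))].
apply: measurable_forall => -[i j] /=.
case iI : (i \in I); last first.
  by rewrite [X in measurable X](_ : _ = setT)//; apply/seteqP; split.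
case jI : (j \notin I); last first.
  by rewrite [X in measurable X](_ : _ = setT)//; apply/seteqP; split.
have := measurable_fun_ltr (mq i) (mq j) measurableT (Y := [set true]) Logic.I.
by rewrite setTI; congr (measurable _); apply/seteqP; split=> x /= => [->|->].
Qed.

(** Fixing the row [k0] fixes the selected set, and the other rows are independent of it; hence the
    bound for a single [I], with no factor for the number of sets. *)
Lemma bad_selection_tail : (P [set w | bad_selection (Z ^~ w)] <= eig_tail%:E)%E.
Proof.
apply: (conditional_le_cst (A := fun p : L * 'I_N => p.1.1 == k0) iZ measurable_bad_selection) => w1.
pose x w2 (p : L * 'I_N) := if p.1.1 == k0 then Z p w1 else Z p w2.
have selE I w2 : selected I (x w2) <-> selected I (Z ^~ w1).
  by rewrite /selected /q0 /x/= eqxx.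
have offE I w2 : off_axis (I := I) (x w2) = off_axis (I := I) (Z ^~ w2).
  apply/funext => j; apply/funext => -[k b]; rewrite /off_axis /x/=.
  by have := valP k; rewrite !inE => /negbTE ->.
have mx := measurable_section (fun p : L * 'I_N => p.1.1 == k0) iZ measurable_bad_selection w1.
have [[I sI]|nI] := pselect (exists I, selected I (Z ^~ w1)); last first.
  rewrite (_ : [set w2 | _] = set0); first by rewrite measure0 lee_fin expR_ge0.
  apply/seteqP; split=> w2 // -[I [sI _]]; apply: nI; exists I; exact/(selE I w2).
apply: le_trans (off_axis_tail (proj1 sI)).
apply: le_measure; rewrite ?inE; first exact: mx.
  apply: (@measurable_small_eig R _ _ T _ eig_level (fun j l w => off_axis (I := I) (Z ^~ w) j l)) => j l.
  by case: iZ => mZ _; exact: mZ.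
move=> w2 [I' [sI' bI']].
have e : I' = I by apply: selected_unique ((selE I' w2).1 sI') sI.
by move: bI'; rewrite e -/(x w2) offE.
Qed.

End null_vector_events.

(** * Numerical exponent for the count of small intensities *)

Section count_exponent.
Variable R : realType.

(** The threshold [51/50 * s] makes the expected count at least [101/100 * m] when [s <= 1/200]. At
    [rho = 199/200] the exponent per unit of [m] is at most [1/199 - 101/20000], which is below
    [- 1/50000]. *)
Lemma count_exponent (m N : nat) (s : R) : (0 < m)%N -> (0 < N)%N ->
  s = m%:R / N%:R -> s <= 1 / 200 ->
  (199 / 200)^-1 ^+ m * expR (- ((1 - 199 / 200) * (1 - expR (- (51 / 50 * s))) * N%:R))
  <= expR (- (m%:R / (50 * 1000))).
Proof.
move=> m0 N0 sE s200.
have m0R : 0 < m%:R :> R by rewrite ltr0n.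
have N0R : 0 < N%:R :> R by rewrite ltr0n.
have s0 : 0 < s by rewrite sE divr_gt0.
have sN : s * N%:R = m%:R by rewrite sE divfK// gt_eqF.
have rE : (199 / 200 : R)^-1 = 1 + 1 / 199 by field.
have h1 : (199 / 200 : R)^-1 ^+ m <= expR (m%:R * (1 / 199)).
  rewrite expRM_natl rE; apply: lerXn2r; last exact: expR_ge1Dx.
    by rewrite nnegrE; lra.
  by rewrite nnegrE; exact: expR_ge0.
have h2 : 101 / 100 * s <= 1 - expR (- (51 / 50 * s)).
  have t0 : 0 < 51 / 50 * s by lra.
  have : expR (- (51 / 50 * s)) <= (1 + 51 / 50 * s)^-1.
    by rewrite expRN lef_pV2 ?posrE ?expR_gt0 ?expR_ge1Dx//; lra.
  have : (1 + 51 / 50 * s)^-1 <= 1 - 101 / 100 * s.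
    rewrite -div1r ler_pdivrMr; last lra.
    nra.
  lra.
have h3 : expR (- ((1 - 199 / 200) * (1 - expR (- (51 / 50 * s))) * N%:R))
    <= expR (- ((1 / 200) * (101 / 100 * s) * N%:R)).
  rewrite ler_expR lerN2 ler_pM2r// (_ : 1 - 199 / 200 = 1 / 200 :> R); last by field.
  by rewrite ler_pM2l; lra.
have a0 : 0 <= (199 / 200 : R)^-1 ^+ m by apply: exprn_ge0; rewrite rE; lra.
apply: le_trans (ler_pM a0 (expR_ge0 _) h1 h3) _.
rewrite -expRD ler_expR.
have -> : 1 / 200 * (101 / 100 * s) * N%:R = 101 / 100 / 200 * m%:R by rewrite -sN; field.
lra.
Qed.

End count_exponent.

(** * The good event and the error bound on it *)

Section good_event.
Context d (T : measurableType d) (R : realType) (P : probability T R).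
Variables (n N m : nat) (X : 'I_n * 'I_N * bool -> T -> R) (x0 : cvec R n).
Notation L := ('I_n * bool)%type.

Let col (w : T) (j : 'I_N) (l : L) : R := X (l.1, j, l.2) w.

Lemma bvecE w j x : bvec X x w j = Num.sqrt (cabs2 (col w j) (flatten_cvec x)).
Proof. by rewrite /bvec -cdot_abs2E. Qed.

Lemma objIE (I : {set 'I_N}) w x :
  objI X I w x = energy (col w) (mem I) (flatten_cvec x).
Proof. by apply: eq_bigr => j _; rewrite -cdot_abs2E. Qed.

Lemma null_vector_event (sigma : R) : (0 < n)%N -> (n < m)%N -> (m < N)%N ->
  iid_normal P X -> cnorm2 x0 != 0 -> sigma = m%:R / N%:R -> sigma <= 1 / 200 ->
  let eta : R := 1 - Num.sqrt (n%:R / m%:R) in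
  exists E : set T, [/\ measurable E,
    forall w, E w -> forall I : {set 'I_N}, #|I| = m ->
      (forall i j, i \in I -> j \notin I -> bvec X x0 w i <= bvec X x0 w j) ->
      forall x : cvec R n, cnorm2 x = cnorm2 x0 ->
      (forall z : cvec R n, cnorm2 z = cnorm2 x0 -> objI X I w x <= objI X I w z) ->
      frob2_rank1_diff x0 x * eta ^+ 2 <= 4 * sigma * cnorm2 x0 ^+ 2 &
    (1 - (expR (- (m%:R / (50 * 1000))) + expR (- (3 / 100 * eta * m%:R)))%:E <= P E)%E].
Proof.
move=> n0 nm mN iX x00 sE s200 eta.
have m0 : (0 < m)%N by exact: ltn_trans nm.
have N0 : (0 < N)%N by exact: ltn_trans mN.
have m0R : 0 < m%:R :> R by rewrite ltr0n.
have N0R : 0 < N%:R :> R by rewrite ltr0n.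
have s0 : 0 < sigma by rewrite sE divr_gt0.
pose k0 : 'I_n := Ordinal n0.
have eta0 : 0 < eta.
  by rewrite subr_gt0 -[ltRHS]sqrtr1 ltr_sqrt// ltr_pdivrMr// mul1r ltr_nat.
pose u0 := flatten_cvec x0.
have r0 : 0 < nrm2 u0 by rewrite lt_neqAle nrm2_ge0 andbT eq_sym -cnorm2E.
have [ O [cO O0]] := unitary_to_axis u0 k0.
have h1 : injective (fun p : L * 'I_N => (p.1.1, p.2, p.1.2)).
  by move=> [[k b] j] [[k' b'] j'] [-> -> ->].
have iZ := iso_iid (proj1 cO) (iid_normal_sub h1 iX).
set Z := (fun (p : L * 'I_N) w => _) in iZ.
have ZE w j : (fun l => Z (l, j) w) = O (col w j) by [].
(* The factor 51/50 matches the one in [eig_level]; the two cancel at the end. *)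
pose tau := 51 / 50 * sigma.
have tau0 : 0 <= tau by rewrite /tau; lra.
have iQ := iid_axis_row k0 iZ.
pose q j w := intensity (axis_row Z k0) j w.
have qE w j : cabs2 (col w j) u0 = q j w * nrm2 u0.
  by rewrite -(cabs2_isometry _ _ cO) (cabs2_axis _ O0) (iso_norm (proj1 cO)).
have q_ge0 j w : 0 <= q j w by rewrite addr_ge0 ?sqr_ge0.
(* Exceptional events: too few small intensities, a small eigenvalue for the selected set, a tie. *)
pose B1 := [set w | (#|[pred j | (intensity (axis_row Z k0) j w < 2 * tau)%R]| < m)%N].
pose B2 := [set w | bad_selection m k0 (Z ^~ w)].
pose B3 := [set w | exists p : 'I_N * 'I_N, (p.1 != p.2) /\ q p.1 w = q p.2 w].
have mq j : measurable_fun [set: T] (q j) by exact: (measurable_intensity iQ).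
have mB1 : measurable B1.
  (* Fewer than [m] small values means that some set of fewer than [m] indices contains them all, a
     finite union. *)
  rewrite (_ : B1 = [set w | exists S : {set 'I_N},
      ([set w | (#|S| < m)%N] `&` [set w | forall j, [set w | j \notin S -> 2 * tau <= q j w] w]) w]).
    apply: measurable_exists => S; apply: measurableI.
      case: (#|S| < m)%N.
        by rewrite [X in measurable X](_ : _ = setT)//; apply/seteqP; split.
      by rewrite [X in measurable X](_ : _ = set0)//; apply/seteqP; split.
    apply: measurable_forall => j; case: (j \notin S).
      rewrite [X in measurable X](_ : _ = [set w | 2 * tau <= q j w]).
        exact: (measurable_intensity_ge iQ).
      by apply/seteqP; split=> w /= H; [exact: H|move=> _].
    by rewrite [X in measurable X](_ : _ = setT)//; apply/seteqP; split.
  apply/seteqP; split=> w.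
    move=> H; exists [set j | (q j w < 2 * tau)%R]%SET; split.
      by rewrite /= cardsE.
    by move=> j /=; rewrite inE -leNgt.
  move=> [S [/= cS H]]; apply: leq_ltn_trans cS; apply: subset_leq_card.
  apply/fintype.subsetP => j; rewrite inE => qj; apply/negPn/negP => jS.
  by have := H j jS; rewrite leNgt qj.
have mB2 : measurable B2.
  rewrite -[X in measurable X]setTI.
  exact: (measurable_rvec (proj1 iZ) measurableT (measurable_bad_selection (R := R) m k0)).
have mqq i j : measurable [set w | q i w = q j w].
  rewrite (_ : [set w | _] = [set: T] `&` (fun w => q i w - q j w) @^-1` [set 0]).
    by apply: measurable_funB.
  apply/seteqP; split=> w /=; first by move=> ->; rewrite subrr.
  by move=> [_ /eqP]; rewrite subr_eq0 => /eqP.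
pose F3 (p : 'I_N * 'I_N) := [set w | (p.1 != p.2) /\ q p.1 w = q p.2 w].
have F3E p : F3 p = if p.1 != p.2 then [set w | q p.1 w = q p.2 w] else set0.
  by rewrite /F3; case: (p.1 != p.2); apply/seteqP; split=> w //= [].
have mF3 p : measurable (F3 p) by rewrite F3E; case: ifP.
have PB3 : P B3 = 0%E.
  apply: (@null_exists _ T R P _ F3 mF3) => p.
  by rewrite F3E; case: ifP => // pp; exact: (intensity_ties iQ).
have mB3 : measurable B3 by exact: (measurable_exists mF3).
exists (~` (B1 `|` (B2 `|` B3))); split.
- by apply: measurableC; apply: measurableU => //; exact: measurableU.
- move=> w wE I cI Imin x nx xmin.
  have nB1 : ~ B1 w by move=> b; apply: wE; left.
  have nB2 : ~ B2 w by move=> b; apply: wE; right; left.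
  have nB3 : ~ B3 w by move=> b; apply: wE; right; right.
  (* Without ties the ordering of the moduli is strict, so [I] is [selected]. *)
  have sel i j : i \in I -> j \notin I -> q i w < q j w.
    move=> iI jI; have := Imin i j iI jI.
    rewrite !bvecE -/u0 !qE ler_sqrt; last by rewrite mulr_ge0// ltW.
    rewrite ler_pM2r// le_eqVlt => /predU1P[e|//]; case: nB3; exists (i, j); split => //=.
    by apply: contraNneq jI => <-.
  have nbad : ~ small_eig (eig_level R n m) (off_axis (k0 := k0) (I := I) (Z ^~ w)).
    by move=> b; apply: nB2; exists I.
  (* A value above the threshold in [I] would confine all small values to the other [m - 1] elements
     of [I]. *)
  have qsmall i : i \in I -> q i w <= 2 * tau.
    move=> iI; rewrite leNgt; apply/negP => qi; apply: nB1.
    rewrite /B1/= -cI (cardsD1 i I) iI add1n ltnS; apply: subset_leq_card.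
    apply/fintype.subsetP => j; rewrite !inE => qj; apply/andP; split.
      by apply: contraTneq qj => ->; rewrite -leNgt ltW.
    apply/negPn/negP => jI; have := sel i j iI jI.
    by rewrite ltNge (ltW (lt_trans _ qi))//.
  pose y := eig_level R n m.
  have yE : y = 51 / 50 * eta ^+ 2 * m%:R by [].
  have y0 : 0 < y by rewrite yE; apply: mulr_gt0 => //; apply: mulr_gt0; [lra|exact: exprn_gt0].
  have hu u : dot u0 u = 0 -> dot u0 (imul u) = 0 -> y * nrm2 u <= energy (col w) (mem I) u.
    move=> du diu; pose a := O u0 (k0, false); pose b := O u0 (k0, true).
    have dE v : dot (O u0) v = a * v (k0, false) + b * v (k0, true).
      rewrite /dot (sum_off k0) big1 ?addr0// => -[k c] /= kk.
      by rewrite O0// mul0r.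
    have abr : a ^+ 2 + b ^+ 2 = nrm2 u0.
      by rewrite /nrm2 -(iso_norm (proj1 cO)) -[RHS]/(dot _ _) dE !expr2.
    (* Orthogonality to [x0] is a linear system for the entry [k0] of [O u], with determinant
       [- (a^2 + b^2)], so that entry vanishes. *)
    have e1 : a * O u (k0, false) + b * O u (k0, true) = 0.
      by rewrite -dE -du; exact: (iid_isometry_dot _ _ (proj1 cO)).
    have e2 : b * O u (k0, false) - a * O u (k0, true) = 0.
      have := iid_isometry_dot u0 (imul u) (proj1 cO).
      rewrite (proj2 cO) -[RHS]/(dot u0 (imul u)) diu -[LHS]/(dot _ _) dE /imul/= => <-.
      by ring.
    have Ouf : O u (k0, false) = 0.
      have : nrm2 u0 * O u (k0, false) = 0.
        rewrite -abr; transitivity (a * (a * O u (k0, false) + b * O u (k0, true))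
          + b * (b * O u (k0, false) - a * O u (k0, true))); first by ring.
        by rewrite e1 e2 !mulr0 addr0.
      by move/eqP; rewrite mulf_eq0 (gt_eqF r0) => /eqP.
    have Out : O u (k0, true) = 0.
      have : nrm2 u0 * O u (k0, true) = 0.
        rewrite -abr; transitivity (b * (a * O u (k0, false) + b * O u (k0, true))
          - a * (b * O u (k0, false) - a * O u (k0, true))); first by ring.
        by rewrite e1 e2 !mulr0 subr0.
      by move/eqP; rewrite mulf_eq0 (gt_eqF r0) => /eqP.
    pose v (l : {k | k \in predC1 k0} * bool) := O u (val l.1, l.2).
    have sumv (f : L -> R) : f (k0, false) = 0 -> f (k0, true) = 0 ->
        \sum_l f l = \sum_(l : {k | k \in predC1 k0} * bool) f (val l.1, l.2).
      move=> f1 f2; rewrite (sum_off k0) f1 f2 !add0r sum_off_pair sum_pair_bool/=.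
      exact: (big_sub _ (fun k => f (k, false) + f (k, true))).
    have nv : nrm2 u = \sum_l v l ^+ 2.
      rewrite /nrm2 -(iso_norm (proj1 cO)); apply: sumv; rewrite ?Ouf ?Out expr0n//.
    have ev j : cabs2 (col w (val j)) u = cabs2 (off_axis (k0 := k0) (I := I) (Z ^~ w) j) v.
      rewrite -(cabs2_isometry _ _ cO) /cabs2; congr (_ ^+ 2 + _ ^+ 2).
        by apply: sumv; rewrite ?Ouf ?Out mulr0.
      rewrite (sumv (fun l => O (col w (val j)) l * imul (O u) l)).
      - by apply: eq_bigr => -[k c] _.
      - by rewrite /imul/= Out oppr0 mulr0.
      - by rewrite /imul/= Ouf mulr0.
    have -> : energy (col w) (mem I) u
        = \sum_j cabs2 (off_axis (k0 := k0) (I := I) (Z ^~ w) j) v.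
      rewrite /energy (big_sub (mem I) (fun j => cabs2 (col w j) u)).
      by apply: eq_bigr => j _; exact: ev.
    rewrite leNgt; apply/negP => lt; apply: nbad.
    (* The violating vector [v] is replaced by a rational one, as [small_eig] demands. *)
    pose f v := \sum_j cabs2 (off_axis (k0 := k0) (I := I) (Z ^~ w) j) v + - (y * \sum_l v l ^+ 2).
    have cf : seq_cont f.
      apply: seq_contD; first by apply: seq_cont_sum => j; exact: seq_cont_cabs2.
      apply: seq_contN; apply: seq_contM; first exact: seq_cont_cst.
      by apply: seq_cont_sum => l; apply: seq_contX2; exact: seq_cont_coord.
    have [|qq hq] := seq_cont_rat cf (u := v).
      by rewrite /f -nv subr_lt0.
    by exists qq; rewrite -subr_lt0.
  have xmin' z : nrm2 z = nrm2 u0 -> energy (col w) (mem I) (flatten_cvec x) <= energy (col w) (mem I) z.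
    move=> nz; have := xmin (unflatten z).
    by rewrite !objIE unflattenK; apply; rewrite !cnorm2E unflattenK.
  have nx' : nrm2 (flatten_cvec x) = nrm2 u0 by rewrite -!cnorm2E.
  have := null_vector_bound r0 nx' xmin' hu.
  have eS : energy (col w) (mem I) u0 <= m%:R * (2 * tau) * nrm2 u0.
    rewrite /energy -cI mulr_natl -sumr_const mulr_suml; apply: ler_sum => j jI.
    by rewrite qE ler_pM2r//; exact: qsmall.
  rewrite frob2_rank1_diffE nx cnorm2E -/u0 => H.
  have H' : y * (nrm2 u0 ^+ 2 - cabs2 u0 (flatten_cvec x)) <= m%:R * (2 * tau) * nrm2 u0 ^+ 2.
    apply: le_trans H _.
    have -> : m%:R * (2 * tau) * nrm2 u0 ^+ 2 = nrm2 u0 * (m%:R * (2 * tau) * nrm2 u0) by ring.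
    by rewrite ler_pM2l.
  move: H'; set c := cabs2 _ _; set r := nrm2 u0; rewrite yE /tau => H'.
  have : m%:R * (51 / 50 * (eta ^+ 2 * (r ^+ 2 - c))) <= m%:R * (51 / 50 * (2 * sigma * r ^+ 2)).
    by move: H'; congr (_ <= _); field.
  rewrite ler_pM2l// ler_pM2l; last lra.
  by lra.
- have mU : measurable (B1 `|` (B2 `|` B3)) by apply: measurableU => //; exact: measurableU.
  have PU : (P (B1 `|` (B2 `|` B3))
      <= (expR (- (m%:R / (50 * 1000))) + expR (- (3 / 100 * eta * m%:R)))%:E)%E.
    apply: le_trans (measureU2 _ mB1 (measurableU _ _ mB2 mB3)) _.
    rewrite EFinD; apply: leeD.
      apply: le_trans (few_small_intensities iQ m (rho := 199 / 200) tau0 _) _; first lra.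
      rewrite lee_fin card_ord; exact: count_exponent.
    apply: le_trans (measureU2 _ mB2 mB3) _.
    rewrite [X in (_ + X)%E]PB3 adde0.
    exact: (bad_selection_tail k0 iZ nm mN).
  rewrite (probability_setC P mU); exact: leeB.
Qed.

End good_event.

(** * Numerical estimates *)

Section budget.
Variable R : realType.

Lemma expR_half_le2 : expR (1 / 2) <= 2 :> R.
Proof.
have E : (1 - 1 / 2)^-1 = 2 :> R by field.
by rewrite -[leRHS]E; apply: expR_le_inv; lra.
Qed.

Lemma two_le_expR1 : 2 <= expR 1 :> R.
Proof. by have := expR_ge1Dx (1 : R). Qed.

Lemma expR1_le3 : expR 1 <= 3 :> R.
Proof. by apply: le_trans (expR_21_20_le3 R); rewrite ler_expR; lra. Qed.

(** With [r = s^(-1/2)], [ln s^-1 = 2 * ln r <= 2 * r]. *)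
Lemma sqr_ln_inv_le (s : R) : 0 < s < 1 -> ln s^-1 ^+ 2 * s <= 4.
Proof.
move=> /andP[s0 s1].
pose r := Num.sqrt s^-1.
have sV : 1 < s^-1 by rewrite invf_gt1.
have r0 : 0 < r by rewrite sqrtr_gt0 invr_gt0.
have r2 : r ^+ 2 = s^-1 by rewrite sqr_sqrtr// invr_ge0 ltW.
have lE : ln s^-1 = 2 * ln r by rewrite -r2 lnXn// mulr_natl.
have l0 : 0 <= ln s^-1 by rewrite ln_ge0// ltW.
have lr : ln r <= r.
  have E : 1 + (r - 1) = r by ring.
  by rewrite -[X in ln X]E; apply: (le_trans (le_ln1Dx _)); lra.
have h : ln s^-1 ^+ 2 <= (2 * r) ^+ 2.
  apply: lerXn2r; rewrite ?nnegrE//; first by rewrite mulr_ge0// ltW.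
  by rewrite lE; lra.
apply: (@le_trans _ _ ((2 * r) ^+ 2 * s)); first by rewrite ler_pM2r.
by rewrite exprMn r2 -mulrA mulVf ?gt_eqF// mulr1; lra.
Qed.

(** As [fl <= m] and [sigma <= (2 * K)^-1], the exponential in [fl] is at least [expR (- (m / K))]
    and absorbs the counting term [expR (- (2 * m / K))]. The eigenvalue term is treated separately
    for [q] below and above [1/2]. *)
Lemma probability_budget (n m N : nat) (K sigma q t fl b : R) :
  1000 <= K ->
  (0 < n)%N -> (n < m)%N -> (m < N)%N ->
  sigma = m%:R / N%:R -> sigma <= (2 * K)^-1 -> q = Num.sqrt (n%:R / m%:R) ->
  0 < t < q^-1 - 1 -> 0 <= fl <= m%:R ->
  let A := (6 * K ^+ 2)^-1 * Num.min (expR 1 ^+ 2 * t ^+ 2 / 16 * ln sigma^-1 ^+ 2 * (m%:R ^+ 2 / N%:R)) b in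
  2 * expR (- A) < 1 ->
  expR (- (2 * m%:R / K)) + expR (- (3 / 100 * (1 - q) * m%:R))
  <= expR (- (2 * fl ^+ 2 / N%:R)) + 2 * expR (- A).
Proof.
move=> K1000 n0 nm mN sE ss0 qE /andP[t0 tq] /andP[fl0 flm] A A1.
pose c := (6 * K ^+ 2)^-1.
have K0 : 0 < K by lra.
have m0 : (0 < m)%N by exact: ltn_trans nm.
have m0R : 0 < m%:R :> R by rewrite ltr0n.
have n0R : 0 < n%:R :> R by rewrite ltr0n.
have N0R : 0 < N%:R :> R by rewrite ltr0n (ltn_trans m0).
have s0 : 0 < sigma by rewrite sE divr_gt0.
have s1 : sigma < 1 by rewrite sE ltr_pdivrMr// mul1r ltr_nat.
have q0 : 0 < q by rewrite qE sqrtr_gt0 divr_gt0.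
have q2 : q ^+ 2 = n%:R / m%:R by rewrite qE sqr_sqrtr// ltW// divr_gt0.
have c0 : 0 < c by rewrite invr_gt0 mulr_gt0// exprn_gt0.
have Aub : A <= 3 * c * (t ^+ 2 * m%:R).
  apply: (@le_trans _ _ (c * (expR 1 ^+ 2 * t ^+ 2 / 16 * ln sigma^-1 ^+ 2 * (m%:R ^+ 2 / N%:R)))).
    by rewrite ler_pM2l// ge_min lexx.
  have -> : 3 * c * (t ^+ 2 * m%:R) = c * (3 * (t ^+ 2 * m%:R)) by ring.
  rewrite ler_pM2l//.
  have -> : expR 1 ^+ 2 * t ^+ 2 / 16 * ln sigma^-1 ^+ 2 * (m%:R ^+ 2 / N%:R)
    = (expR 1 ^+ 2 / 16 * (ln sigma^-1 ^+ 2 * sigma)) * (t ^+ 2 * m%:R).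
    by rewrite sE; field; rewrite gt_eqF.
  rewrite ler_pM2r; last by rewrite mulr_gt0// exprn_gt0.
  have e9 : expR 1 ^+ 2 <= 9 :> R.
    have -> : 9 = 3 ^+ 2 :> R by ring.
    by apply: lerXn2r; rewrite ?nnegrE ?expR_ge0//; exact: expR1_le3.
  have l4 : ln sigma^-1 ^+ 2 * sigma <= 4 by apply: sqr_ln_inv_le; rewrite s0.
  have l0 : 0 <= ln sigma^-1 ^+ 2 * sigma by rewrite mulr_ge0 ?sqr_ge0// ltW.
  apply: (@le_trans _ _ (9 / 16 * 4)); last lra.
  by apply: ler_pM => //; lra.
have p2 : expR (- (m%:R / K)) <= expR (- (2 * fl ^+ 2 / N%:R)) :> R.
  rewrite ler_expR lerN2.
  apply: (@le_trans _ _ (2 * sigma * m%:R)).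
    have -> : 2 * sigma * m%:R = 2 * m%:R ^+ 2 / N%:R by rewrite sE; field; rewrite gt_eqF.
    rewrite ler_pM2r ?invr_gt0// ler_pM2l//.
    by apply: lerXn2r; rewrite ?nnegrE// ltW.
  have -> : m%:R / K = 2 * (2 * K)^-1 * m%:R :> R by field; rewrite gt_eqF.
  by rewrite ler_pM2r// ler_pM2l.
have p1 : expR (- (2 * m%:R / K)) <= expR (- (m%:R / K)) :> R.
  by rewrite ler_expR lerN2 ler_pM2r ?invr_gt0//; lra.
have q1 : q < 1.
  have : 1 < q^-1 by lra.
  by rewrite invf_gt1.
(* For small [q], [2 * expR (- A) < 1] forces [A > 1/2], while [t^2 <= 1/q^2 <= m] gives
   [A <= 3 * c * m^2]. As [3 * c * K^2 = 1/2], this needs [m >= K], and then both failure terms fit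
   in the exponential in [fl]. *)
have [qh|qh] := leP q (1 / 2).
- have Ah : 1 / 2 < A.
    rewrite -ltr_expR; apply: le_lt_trans expR_half_le2 _.
    by rewrite -(ltr_pM2r (expR_gt0 (- A))) -expRD subrr expR0.
  have tm : t ^+ 2 <= m%:R.
    have tq' : t <= q^-1 by lra.
    apply: (@le_trans _ _ (q^-1 ^+ 2)).
      by apply: lerXn2r => //; rewrite nnegrE ?invr_ge0 ltW.
    by rewrite exprVn q2 invf_div ler_pdivrMr// ler_peMr ?(ltW m0R)// ler1n.
  have mbig : K <= m%:R :> R.
    rewrite leNgt; apply/negP => mlt.
    have h : t ^+ 2 * m%:R <= K ^+ 2.
      rewrite expr2; apply: ler_pM; rewrite ?sqr_ge0 ?(ltW m0R) ?(ltW mlt)//.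
      by apply: le_trans tm _; exact: ltW.
    have : A <= 3 * c * K ^+ 2.
      by apply: le_trans Aub _; rewrite ler_pM2l// mulr_gt0.
    have -> : 3 * c * K ^+ 2 = 1 / 2 by rewrite /c; field; rewrite gt_eqF.
    by rewrite leNgt Ah.
  have e1 : expR (- (3 / 100 * (1 - q) * m%:R)) <= expR (- (2 * m%:R / K)).
    rewrite ler_expR lerN2 mulrAC ler_pM2r// ler_pdivrMr//.
    nra.
  have e2 : 2 * expR (- (2 * m%:R / K)) <= expR (- (m%:R / K)) :> R.
    have -> : expR (- (m%:R / K))
      = expR (m%:R / K) * expR (- (2 * m%:R / K)) :> R.
      by rewrite -expRD; congr expR; field; rewrite gt_eqF.
    rewrite ler_pM2r ?expR_gt0//; apply: le_trans two_le_expR1 _; rewrite ler_expR.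
    by rewrite ler_pdivlMr// mul1r.
  have := expR_ge0 (- A); lra.
(* For [q > 1/2] the range of [t] shrinks with [1 - q], so [A] is at most the eigenvalue exponent
   and that term is at most [expR (- A)]. *)
- have t2 : t <= 2 * (1 - q).
    apply: (@le_trans _ _ (q^-1 - 1)); first exact: ltW.
    have -> : q^-1 - 1 = (1 - q) / q by field; rewrite gt_eqF.
    rewrite ler_pdivrMr//; nra.
  have e1 : expR (- (3 / 100 * (1 - q) * m%:R)) <= expR (- A).
    rewrite ler_expR lerN2; apply: le_trans Aub _.
    rewrite mulrA ler_pM2r//.
    have tt : t ^+ 2 <= 4 * (1 - q).
      apply: (@le_trans _ _ ((2 * (1 - q)) ^+ 2)).
        by apply: lerXn2r; rewrite ?nnegrE ?(ltW t0)//; lra.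
      nra.
    have cs : c <= 1 / 400.
      by rewrite /c div1r lef_pV2 ?posrE; nra.
    have : c * t ^+ 2 <= 1 / 400 * (4 * (1 - q)).
      by apply: ler_pM => //; rewrite ?sqr_ge0 ?ltW.
    lra.
  have := expR_ge0 (- A); lra.
Qed.

End budget.

(** The coefficient [(2 + t) / (1 - eps)] is at least 2, the term with the logarithm is nonnegative,
    and [0 < 1 - (1 + t) * q <= 1 - q]. *)
Lemma error_bound_le (R : realType) (sigma eps delta t q rho f : R) :
  0 < sigma < 1 -> 0 < eps < 1 -> 0 < delta -> 0 < q -> 0 < t < q^-1 - 1 ->
  f * (1 - q) ^+ 2 <= 4 * sigma * rho ^+ 2 ->
  f <= (((2 + t) / (1 - eps)) * sigma + eps * (- (2 * ln (1 - sigma)) + delta))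
       * (2 * rho ^+ 2) / (1 - (1 + t) * q) ^+ 2.
Proof.
move=> /andP[s0 s1] /andP[e0 e1] d0 q0 /andP[t0 tq] hf.
have D0 : 0 < 1 - (1 + t) * q.
  have : (1 + t) * q < 1 by rewrite -ltr_pdivlMr// mul1r; lra.
  lra.
have tq0 : 0 <= t * q by rewrite mulr_ge0 ?ltW.
rewrite ler_pdivlMr; last exact: exprn_gt0.
apply: (@le_trans _ _ (4 * sigma * rho ^+ 2)); last first.
  have -> : 4 * sigma * rho ^+ 2 = 2 * sigma * (2 * rho ^+ 2) by ring.
  apply: ler_wpM2r; first by rewrite mulr_ge0// sqr_ge0.
  have L0 : ln (1 - sigma) <= 0 by rewrite ln_le0//; lra.
  have E0 : 0 <= eps * (- (2 * ln (1 - sigma)) + delta) by rewrite mulr_ge0//; lra.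
  have : 2 * sigma <= (2 + t) / (1 - eps) * sigma.
    by rewrite ler_pM2r// ler_pdivlMr; lra.
  lra.
have [f0|f0] := leP 0 f.
  apply: le_trans hf; apply: ler_wpM2l => //.
  by apply: lerXn2r; rewrite ?nnegrE; lra.
apply: (@le_trans _ _ 0).
  by rewrite nmulr_rle0// sqr_ge0.
by rewrite mulr_ge0 ?sqr_ge0// mulr_ge0// ltW.
Qed.

(** * Assembly of the error and probability bounds *)

Theorem theorem1 (R : realType) :
  exists c : R, 0 < c /\ exists s0 : R, 0 < s0 /\
  forall (d : measure_display) (T : measurableType d) (P : probability T R)
    (n N m : nat) (X : 'I_n * 'I_N * bool -> T -> R) (x0 : cvec R n)
    (eps delta t : R),
    (0 < n)%N -> (n < N)%N ->
    (forall i, measurable_fun setT (X i)) ->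
    mutual_indep P X ->
    (forall i (B : set R), measurable B -> P (X i @^-1` B) = normal_prob 0 1 B) ->
    cnorm2 x0 != 0 ->
    let sigma : R := m%:R / N%:R in
    let nu : R := n%:R / m%:R in
    sigma < 1 -> nu < 1 -> sigma <= s0 ->
    0 < eps < 1 -> 0 < delta -> 0 < t < (Num.sqrt nu)^-1 - 1 ->
    let Q : R := 2 * expR (- (c * Num.min
          (expR 1 ^+ 2 * t ^+ 2 / 16%:R * (ln sigma^-1) ^+ 2 * (m%:R ^+ 2 / N%:R))
          (expR 1 * t / 4%:R * m%:R * ln sigma^-1))) in
    let bound : R :=
      (((2 + t) / (1 - eps)) * sigma + eps * (- (2 * ln (1 - sigma)) + delta))
      * (2 * cnorm2 x0 ^+ 2) / (1 - (1 + t) * Num.sqrt nu) ^+ 2 in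
    let good : set T := fun w =>
      forall I : {set 'I_N}, #|I| = m ->
      (forall i j, i \in I -> j \notin I -> bvec X x0 w i <= bvec X x0 w j) ->
      forall x : cvec R n, cnorm2 x = cnorm2 x0 ->
      (forall z : cvec R n, cnorm2 z = cnorm2 x0 -> objI X I w x <= objI X I w z) ->
      frob2_rank1_diff x0 x <= bound in
    exists E : set T, measurable E /\ E `<=` good /\
      ((1 - 2 * expR (- (N%:R * delta ^+ 2 * expR (- delta) * `|1 - sigma| ^+ 2 / 2))
          - expR (- (2 * ((Num.floor (m%:R * eps))%:~R) ^+ 2 / N%:R))
          - Q)%:E <= P E)%E.
Proof.
(* [K] makes [2 * m / K] the counting exponent [m / 50000]; it also fixes the absolute constant
   [(6 * K^2)^-1] and the range [(2 * K)^-1] of [sigma]. *)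
pose K : R := 100 * 1000.
have K1000 : 1000 <= K by rewrite /K; lra.
have K0 : 0 < K by lra.
have mK m : 2 * m%:R / K = m%:R / (50 * 1000) by rewrite /K; field.
clearbody K.
exists (6 * K ^+ 2)^-1; split; first by rewrite invr_gt0 mulr_gt0// exprn_gt0.
exists (2 * K)^-1; split; first by rewrite invr_gt0 mulr_gt0.
move=> d T P n N m X x0 eps delta t n0 nN mX iX XN x00 sigma nu s1 nu1 ss0 eps01 delta0 tq Q bound good.
have /andP[t0 tq'] := tq.
(* For [m = 0] the convention for division by zero gives [nu = 0] and an empty range for [t]. *)
have m0 : (0 < m)%N.
  rewrite lt0n; apply/eqP => m0; move: tq'.
  by rewrite /nu m0 invr0 mulr0 sqrtr0 invr0; lra.
have m0R : 0 < m%:R :> R by rewrite ltr0n.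
have N0R : 0 < N%:R :> R by rewrite ltr0n (ltn_trans n0).
have nm : (n < m)%N by move: nu1; rewrite /nu ltr_pdivrMr// mul1r ltr_nat.
have mN : (m < N)%N by move: s1; rewrite /sigma ltr_pdivrMr// mul1r ltr_nat.
have s0 : 0 < sigma by rewrite divr_gt0.
have q0 : 0 < Num.sqrt nu by rewrite sqrtr_gt0 divr_gt0// ltr0n.
(* If [Q >= 1], the claimed probability is not positive and the empty event suffices. *)
have [Q1|Q1] := leP 1 Q.
  exists set0; split; first exact: measurable0.
  split; first by move=> w.
  rewrite measure0 lee_fin.
  set p1 := expR _; set p2 := expR _.
  have := expR_ge0 (- (N%:R * delta ^+ 2 * expR (- delta) * `|1 - sigma| ^+ 2 / 2)).
  have : 0 <= p2 by exact: expR_ge0.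
  rewrite -/p1; lra.
have s200 : sigma <= 1 / 200 by apply: le_trans ss0 _; rewrite div1r lef_pV2 ?posrE; lra.
have [E [mE Egood EP]] := null_vector_event n0 nm mN (iid_normal_of_indep mX iX XN) x00 erefl s200.
exists E; split => //; split.
  move=> w /Egood H I cI mI x cx mx.
  by apply: error_bound_le => //; [rewrite s0|exact: H cI mI x cx mx].
apply: le_trans EP; rewrite lee_fin -mK.
pose fl : R := (Num.floor (m%:R * eps))%:~R.
have fl0 : 0 <= fl <= m%:R.
  case/andP: eps01 => e0 e1; apply/andP; split.
    by rewrite ler0z floor_ge0 mulr_ge0// ltW.
  by apply: le_trans (floor_le _) _; rewrite ger_pMr// ltW.
have := probability_budget K1000 n0 nm mN erefl ss0 erefl tq fl0 Q1.
have := expR_ge0 (- (N%:R * delta ^+ 2 * expR (- delta) * `|1 - sigma| ^+ 2 / 2)).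
rewrite -/Q.
set a1 := expR _; set a2 := expR _; set a3 := expR _; set a4 := expR _.
lra.
Qed.
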